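(* A real sequence $\{\rho_n\}_{n=1}^{\infty}$ is an expected record sequence corresponding to a non-degenerate random variable $X$ if and only if $$\frac{\rho_{n+2}-\rho_{n+1}}{\rho_2-\rho_1}=\frac{\mathbb{E}\,T^n}{(n+1)!},\qquad n=0,1,\ldots,$$ for some random variable $T$, with $\Pr(T>0)=1$, possessing finite moments of any order.
   Context: For a random variable $X$ with distribution function $F$, let $F^{-1}(u)=\inf\{x\in\mathbb{R}:F(x)\ge u\}$, $0<u<1$, be its left-continuous inverse distribution function. Let $U_1<U_2<\cdots$ be the sequence of (upper) record values of an i.i.d. sequence $V_1,V_2,\ldots$ from the uniform distribution on $(0,1)$: $\tau_1=1$, $U_1=V_1$, and, inductively, $\tau_{n+1}=\inf\{m>\tau_n: V_m>U_n\}$, $U_{n+1}=V_{\tau_{n+1}}$. The records of $X$ are defined by $R_n=F^{-1}(U_n)$, $n\ge 1$. A real sequence $\{\rho_n\}_{n\ge1}$ is an expected record sequence corresponding to $X$ if $\mathbb{E}R_n$ is finite and $\mathbb{E}R_n=\rho_n$ for all $n\ge1$.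
   Formalization: The condition ρ_1 < ρ_2 is added to the right-hand side of the equivalence; without it the ''if'' direction fails, e.g. for ρ_n = −n with T Gamma(2,1)-distributed, since the ratio is unchanged when ρ is replaced by −ρ. *)

(* Defs.v *)
From HB Require Import structures.
From mathcomp Require Import all_boot all_order all_algebra.
From mathcomp Require Import all_classical all_reals all_analysis.

Set Implicit Arguments.
Unset Strict Implicit.
Unset Printing Implicit Defensive.

Import Order.TTheory GRing.Theory Num.Theory.
Import numFieldNormedType.Exports.

Local Open Scope classical_set_scope.
Local Open Scope ring_scope.

(* All sequences are indexed from 0: index n here is index n + 1 in the usual
   numbering V_1, V_2, ..., U_1, U_2, ..., R_1, R_2, ..., rho_1, rho_2, ... *)

(* Only used for 0 < u < 1, where the set below is nonempty and bounded from
   below whenever F is a distribution function. *)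
Definition left_inverse (R : realType) (F : R -> \bar R) (u : R) : R :=
  inf [set x : R | (u%:E <= F x)%E].

(* inf {m > k : v m > v k}. If this set is empty, which has probability 0 for
   an i.i.d. uniform sequence, the value is k. *)
Definition next_record_time (R : realType) (v : nat -> R) (k : nat) : nat :=
  match pselect (exists m, (k < m)%N && (v k < v m)) with
  | left e => ex_minn e
  | right _ => k
  end.

Definition record_time (R : realType) (v : nat -> R) (n : nat) : nat :=
  iter n (next_record_time v) 0%N.

Definition record_value (R : realType) (v : nat -> R) (n : nat) : R :=
  v (record_time v n).

Definition mutually_independent (R : realType) (d : measure_display)
    (Omega : measurableType d) (P : probability Omega R)
    (V : nat -> {RV P >-> R}) : Prop :=
  forall (I : seq nat) (A : nat -> set R), uniq I ->
    (forall i, measurable (A i)) ->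
    P (\bigcap_(i in [set` I]) (V i @^-1` A i)) =
      (\prod_(i <- I) P (V i @^-1` A i))%E.

Definition iid_uniform (R : realType) (d : measure_display)
    (Omega : measurableType d) (P : probability Omega R)
    (V : nat -> {RV P >-> R}) : Prop :=
  mutually_independent V /\
  forall (i : nat) (A : set R), measurable A ->
    distribution P (V i) A = uniform_prob (@ltr01 R) A.

Definition non_degenerate (R : realType) (d : measure_display)
    (Omega : measurableType d) (P : probability Omega R)
    (X : {RV P >-> R}) : Prop :=
  ~ exists c : R, P [set w | X w = c] = 1%E.

(* The records R_n = F^{-1}(U_n) of X live on the space of the uniform sequence
   V; only the distribution function of X is used. *)
Definition record_of (R : realType) (d : measure_display)
    (Omega : measurableType d) (P : probability Omega R)
    (V : nat -> {RV P >-> R}) (d' : measure_display)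
    (Omega' : measurableType d') (P' : probability Omega' R)
    (X : {RV P' >-> R}) (n : nat) : Omega -> R :=
  fun w => left_inverse (cdf X) (record_value (fun i => V i w) n).

Definition expected_record_sequence (R : realType) (d : measure_display)
    (Omega : measurableType d) (P : probability Omega R)
    (V : nat -> {RV P >-> R}) (d' : measure_display)
    (Omega' : measurableType d') (P' : probability Omega' R)
    (X : {RV P' >-> R}) (rho : nat -> R) : Prop :=
  forall n : nat,
    P.-integrable setT (EFin \o record_of V X n) /\
    ('E_P[record_of V X n])%E = (rho n)%:E.

(* Main.v *)
Require Import Defs.
From HB Require Import structures.
From mathcomp Require Import all_boot all_order all_algebra.
From mathcomp Require Import all_classical all_reals all_analysis.
From mathcomp Require Import measurable_realfun.
From mathcomp Require Import ring lra.

Import Order.TTheory GRing.Theory Num.Theory.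
Import numFieldNormedType.Exports.

Local Open Scope classical_set_scope.
Local Open Scope ring_scope.

(** The law of the record values of a uniform sequence carries the proof. Write
    L(x) = - ln (1 - x). The n-th record value U_n (numbered from 0) satisfies

      P (U_n > x) = (1 - x) * sum_(k <= n) L(x)^k / k!        for 0 <= x <= 1

    ([record_value_survival]), so the passage from U_n to U_(n+1) adds
    (1 - x) * L(x)^(n+1) / (n+1)! to the tail ([record_gain]).

    To find this law, fix a level x and read the V_i one at a time, keeping
    the current record and the number of records still to come. This is a
    Markov chain ([integral_chain_step]). A closed formula [exceed_prob] gives
    the probability that the final record will be above x; it is a martingale
    along the chain ([integral_exceed_prob_step]), because one
    integration adds exactly one term to the sum ([integral_expsum_logratio]). It starts at the announced tail, and it ends
    almost surely at the indicator of U_n > x.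

    Let now F be the distribution function of X and Q its left-continuous
    inverse. Since Q(u) <= x exactly when u <= F(x), the number Q(u) is the
    length of the set of x >= 0 with F(x) < u minus the length of the set of
    x < 0 with u <= F(x). Exchanging integrals gives

      E R_(n+1) - E R_n = \int (1 - F) * L(F)^(n+1) / (n+1)! dx

    ([record_expectation_increment]). For n = 0 this is a positive number c
    when X is non-degenerate, and T = L(F(x)) is the required random variable
    on the real line with density (1 - F) * L(F) / c
    ([records_moment_sequence]).

    Read backwards, the formula says that the image under L o F of the Lebesgue
    measure on the set where 0 < F < 1 should be c * e^t / t times the law of T. This measure may be
    infinite both near 0 and near infinity, but it is finite in between, so it
    has a two-sided distribution function: the mass of the t in [1, s) for
    s > 1, and minus the mass of the t in [s, 1) for s < 1. In the variable
    u = 1 - e^(-s) it is nondecreasing and left-continuous on (0, 1), hence it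
    is the left-continuous inverse of the distribution function of its own
    value at V_0 ([quantile_transform]). A translation adjusts the first
    expected record ([moments_record_sequence]).

    Both directions use one device: a function on (0, 1) is written as the mass
    of phi on the points whose level a(s) is below u minus the mass of psi
    on the points whose level is at least u ([mass_below], [mass_above]). *)

Set Implicit Arguments.
Unset Strict Implicit.
Unset Printing Implicit Defensive.

(** * Measurability *)

Section measurability.
Context (R : realType) (d : measure_display) (T : measurableType d).

Lemma measurable_invr : measurable_fun setT (@GRing.inv R).
Proof.
rewrite (_ : GRing.inv = fun y : R => if y == 0 then 0 else y^-1); last first.
  by apply/funext => y; case: eqP => // ->; rewrite invr0.
apply: measurable_fun_if => //; first exact: measurable_fun_eqr.
rewrite setTI; apply: open_continuous_measurable_fun.
  rewrite (_ : _ @^-1` _ = [set x | x != 0]); last first.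
    by apply/seteqP; split => y /=; [move=> -> |move/negbTE].
  exact: open_neq.
by move=> y; rewrite inE/= => /negbT y0; exact: inv_continuous.
Qed.

Lemma measurable_natr_bool (b : T -> bool) :
  measurable_fun setT b -> measurable_fun setT (fun t => (b t)%:R : R).
Proof.
move=> mb; rewrite (_ : (fun t => _) = fun t => if b t then 1 else 0).
  exact: measurable_fun_ifT.
by apply/funext => t; case: (b t).
Qed.

Lemma measurable_set_lt (f g : T -> R) : measurable_fun setT f ->
  measurable_fun setT g -> measurable [set t | f t < g t].
Proof.
move=> mf mg.
have mb : measurable_fun setT (fun t => f t < g t) by exact: measurable_fun_ltr.
by have := mb measurableT [set true]; rewrite setTI; exact.
Qed.

End measurability.

(** * Markov chains driven by an independent sequence *)

Section driven_chain.
Context (R : realType) (d : measure_display)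
    (Omega : measurableType d) (P : probability Omega R)
    (V : nat -> {RV P >-> R}) (d' : measure_display) (T : measurableType d')
    (f : T * R -> T) (mf : measurable_fun setT f) (z0 : T).

Fixpoint chain (k : nat) (w : Omega) : T :=
  if k is k'.+1 then f (chain k' w, V k' w) else z0.

Lemma measurable_chain k : measurable_fun setT (chain k).
Proof.
elim: k => [|k IH] /=; first exact: measurable_cst.
apply: measurableT_comp => //; apply: measurable_fun_pair => //.
Qed.

Hypothesis indV : mutually_independent V.

Definition future_event (I : seq nat) (A : nat -> set R) : set Omega :=
  \bigcap_(i in [set` I]) (V i @^-1` A i).

Lemma measurable_future_event I A : (forall i, measurable (A i)) ->
  measurable (future_event I A).
Proof.
move=> mA; apply: fin_bigcap_measurable => [|i _]; first exact: finite_seq.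
exact: measurable_funPTI.
Qed.

Let indep_past k := forall (B : set T) (I : seq nat) (A : nat -> set R),
  measurable B -> uniq I -> (forall i, i \in I -> (k <= i)%N) ->
  (forall i, measurable (A i)) ->
  P (chain k @^-1` B `&` future_event I A) =
  (P (chain k @^-1` B) * P (future_event I A))%E.

Let mfun_pair k : {mfun Omega >-> (T * R)%type} :=
  HB.pack (fun w => (chain k w, V k w)) (isMeasurableFun.Build _ _ _ _ _
    (measurable_fun_pair (measurable_chain k) (measurable_funPT (V k)))).

Lemma future_event_cons i I A : future_event (i :: I) A =
  V i @^-1` A i `&` future_event I A.
Proof.
rewrite /future_event -(bigcap_setU1 (fun j => V j @^-1` A j)).
congr (\bigcap_(_ in _) _).
apply/seteqP; split => j /=; rewrite inE.
  by case/predU1P => [->|?]; [left|right].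
by case=> [->|->]; rewrite ?eqxx ?orbT.
Qed.

(** Independence for the pair (state, next variable) is known on rectangles, by
    the hypothesis applied twice: once to the enlarged list of indices k :: I
    and once to the single index k. Rectangles determine a finite measure on
    the product, so it extends to every measurable set of pairs. *)
Let indep_past_next k : indep_past k ->
  forall (C : set (T * R)) (I : seq nat) (A : nat -> set R),
  measurable C -> uniq I -> (forall i, i \in I -> (k < i)%N) ->
  (forall i, measurable (A i)) ->
  P ((fun w => (chain k w, V k w)) @^-1` C `&` future_event I A) =
  (P ((fun w => (chain k w, V k w)) @^-1` C) * P (future_event I A))%E.
Proof.
move=> Hk C I A mC uI kI mA.
have mE := measurable_future_event I mA.
have fE : P (future_event I A) \is a fin_num by exact: fin_num_measure.
pose r : {nonneg R} := NngNum (fine_ge0 (measure_ge0 P (future_event I A))).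
have mZV := measurable_funPT (mfun_pair k).
(* a pushforward is a measure given a proof that the map is measurable; the
   proof is the argument of m1_ *)
pose m1_ : {measure set (T * R)%type -> \bar R} :=
  pushforward (mrestr P mE) (mfun_pair k).
pose m1 := m1_ mZV.
pose m2 : {measure set (T * R)%type -> \bar R} :=
  mscale r (distribution P (mfun_pair k)).
have m2E X : m2 X = (P (future_event I A) * P (mfun_pair k @^-1` X))%E.
  by rewrite -[in RHS](fineK fE).
suff H : m1 C = m2 C by rewrite muleC -m2E.
apply: (measure_unique [set A `*` B | A in measurable & B in measurable]
  (fun=> setT)) => //.
- exact: measurable_prod_measurableType.
- move=> _ _ [X1 mX1 [X2 mX2 <-]] [Y1 mY1 [Y2 mY2 <-]].
  rewrite -setXI; exists (X1 `&` Y1); first exact: measurableI.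
  by exists (X2 `&` Y2) => //; exact: measurableI.
- by move=> _; exists setT => //; exists setT => //; rewrite setXTT.
- by rewrite bigcup_const.
- move=> _ [B mB [D mD <-]].
  (* the joint event of V_k and the later variables is a future event at k *)
  pose A' i := if i == k then D else A i.
  have mA' i : measurable (A' i) by rewrite /A'; case: ifP.
  have kNI : k \notin I by apply/negP => /kI; rewrite ltnn.
  have -> : m1 (B `*` D) = P (chain k @^-1` B `&` future_event (k :: I) A').
    rewrite future_event_cons setIA /m1 /= /pushforward /mrestr /A' eqxx.
    congr (P (_ `&` _)); apply: eq_bigcapr => i /= iI.
    by case: eqP iI kNI => // -> ->.
  have m2BD : m2 (B `*` D) = (P (future_event I A) *
      P (chain k @^-1` B `&` future_event [:: k] A'))%E.
    rewrite future_event_cons m2E /A' eqxx.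
    rewrite /future_event (_ : [set` [::]] = set0) ?bigcap_set0 ?setIT//.
    by rewrite -subset0 => j.
  have leI i : i \in k :: I -> (k <= i)%N by rewrite inE => /predU1P[->//|/kI/ltnW].
  rewrite m2BD !Hk /= ?kNI ?uI//; last by move=> i; rewrite inE => /eqP ->.
  rewrite muleCA; congr (_ * _)%E.
  rewrite /future_event !indV//= ?kNI ?uI//.
  rewrite big_cons big_seq1 muleC; congr (_ * _)%E.
  apply: eq_big_seq => i iI; rewrite /A'.
  by case: eqP iI kNI => // -> ->.
- move=> _; rewrite /m1 /= /pushforward /mrestr.
  rewrite (le_lt_trans (probability_le1 _ _)) ?ltry//.
  by rewrite preimage_setT setTI.
Qed.

(** The next state is a function of the pair (state, next variable), so
    independence from the later variables propagates along the chain. *)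
Lemma chain_indep_future k : indep_past k.
Proof.
elim: k => [|k IH] B I A mB uI kI mA.
  rewrite /=; have [Bz|nBz] := pselect (B z0).
    rewrite (_ : _ @^-1` B = setT) ?setTI ?probability_setT ?mul1e//.
    by apply/seteqP; split.
  rewrite (_ : _ @^-1` B = set0) ?set0I ?measure0 ?mul0e//.
  by apply/seteqP; split.
rewrite -[X in P (X `&` _)]/((fun w => (chain k w, V k w)) @^-1` (f @^-1` B)).
by rewrite indep_past_next// -[X in measurable X]setTI; exact: mf.
Qed.

(** The Markov property in integral form. The state is independent of the next
    variable, so their joint law is a product and Tonelli integrates the
    variable first. *)
Lemma integral_chain_step k (h : T -> \bar R) :
  measurable_fun setT h -> (forall z, 0 <= h z)%E ->
  (\int[P]_w h (chain k.+1 w) =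
   \int[P]_w \int[distribution P (V k)]_v h (f (chain k w, v)))%E.
Proof.
move=> mh h0.
pose Zk : {mfun Omega >-> T} :=
  HB.pack (chain k) (isMeasurableFun.Build _ _ _ _ _ (measurable_chain k)).
have mhf : measurable_fun setT (h \o f) by exact: measurableT_comp.
have -> : (\int[P]_w h (chain k.+1 w) =
    \int[distribution P (mfun_pair k)]_z (h \o f) z)%E.
  by rewrite [RHS]ge0_integral_pushforward// => z _; exact: h0.
have prodE (A : set (T * R)) : measurable A -> A `<=` setT ->
    distribution P (mfun_pair k) A = (distribution P Zk \x distribution P (V k))%E A.
  move=> mA _; apply/esym/product_measure_unique => // B D mB mD.
  pose A' := fun i : nat => D.
  have := @chain_indep_future k B [:: k] A' mB isT.
  rewrite future_event_cons /future_event (_ : [set` [::]] = set0); last first.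
    by rewrite -subset0 => j.
  rewrite bigcap_set0 setIT; apply => //.
  by move=> i; rewrite inE => /eqP ->.
rewrite (eq_measure_integral _ prodE).
rewrite fubini_tonelli1//=.
rewrite [LHS]ge0_integral_pushforward//=.
- exact: measurable_chain.
- by apply: measurable_fun_fubini_tonelli_F => // z; exact: h0.
- by move=> z _; apply: integral_ge0 => v _; exact: h0.
Qed.

End driven_chain.

(** * Truncated exponential series *)

Section expsum.
Context (R : realType).
Implicit Types (x u v y : R) (j : nat).

Definition expsum j y : R := \sum_(k < j) y ^+ k / k`!%:R.

Lemma expsumS j y : expsum j.+1 y = expsum j y + y ^+ j / j`!%:R.
Proof. by rewrite /expsum big_ord_recr. Qed.

Lemma expsum_at0 j : expsum j.+1 0 = 1.
Proof.
elim: j => [|j IH]; first by rewrite /expsum big_ord1 expr0 fact0 divr1.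
by rewrite expsumS IH expr0n mul0r addr0.
Qed.

Lemma expsum_ge0 j y : 0 <= y -> 0 <= expsum j y.
Proof.
by move=> y0; apply: sumr_ge0 => k _; rewrite divr_ge0 ?exprn_ge0 ?ler0n.
Qed.

Lemma expsum_le n y z : 0 <= y <= z -> expsum n y <= expsum n z.
Proof.
move=> /andP[y0 yz]; apply: ler_sum => k _.
by rewrite ler_wpM2r ?invr_ge0// lerXn2r ?nnegrE// (le_trans y0).
Qed.

Lemma expsum_homo y m n : 0 <= y -> (m <= n)%N -> expsum m y <= expsum n y.
Proof.
move=> y0 /subnK <-; elim: (n - m)%N => [|k IH]; first by rewrite add0n.
by rewrite addSn expsumS (le_trans IH)// lerDl divr_ge0 ?exprn_ge0.
Qed.

(** The identity (y^j / j!)' = y^(j-1) / (j-1)! is what makes one step of the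
    record chain lengthen the sum by one term. *)
Lemma expsum_is_derive j y : is_derive y 1 (expsum j.+1) (expsum j y).
Proof.
elim: j y => [|j IH] y.
  rewrite (_ : expsum 1 = cst 1); last first.
    by apply/funext => z; rewrite /expsum big_ord1 expr0 fact0 divr1.
  by have -> : expsum 0 y = 0; [rewrite /expsum big_ord0|exact: is_derive_cst].
rewrite (_ : expsum j.+2 =
    expsum j.+1 + (j.+1`!%:R^-1 \*: ((@id R) ^+ j.+1))); last first.
  by apply/funext => z; rewrite expsumS mulrC /= !fctE.
rewrite expsumS; apply: is_deriveD.
have := @is_deriveZ _ _ _ _ j.+1`!%:R^-1 y 1 _
  (is_deriveX j.+1 (is_derive_id y 1)).
move=> H; apply: (is_derive_eq H).
rewrite /GRing.scale/= mulr1 factS natrM; field.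
by rewrite nat1r !pnatr_eq0 -lt0n fact_gt0.
Qed.

Lemma continuous_expsum j : continuous (expsum j).
Proof.
case: j => [|j] y.
  rewrite (_ : expsum 0 = cst 0); first exact: cvg_cst.
  by apply/funext => z; rewrite /expsum big_ord0.
apply: differentiable_continuous; apply/derivable1_diffP.
by have [] := expsum_is_derive j y.
Qed.

Lemma is_derive_onem_ln v c : v < 1 ->
  is_derive v 1 (fun y => ln (1 - y) - c) (- (1 - v)^-1).
Proof.
move=> v1.
have H1 : is_derive v 1 (fun y : R => 1 - y) (-1).
  have H := is_deriveB (is_derive_cst (1 : R) v 1) (is_derive_id v 1).
  by apply: (is_derive_eq H); rewrite sub0r.
have H2 : is_derive (1 - v) 1 (@ln R) (1 - v)^-1.
  by apply: is_derive1_ln; rewrite subr_gt0.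
have H3 := @is_derive1_comp _ (@ln R) (fun y => 1 - y) _ _ _ H2 H1.
have H := is_deriveB H3 (is_derive_cst c v 1).
by apply: (is_derive_eq H); rewrite mulrN1 subr0.
Qed.

Definition logratio x u : R := ln (1 - u) - ln (1 - x).

Lemma measurable_expsum_logratio j x :
  measurable_fun setT (fun u => expsum j (logratio x u)).
Proof.
apply: measurableT_comp.
  by apply: continuous_measurable_fun; exact: continuous_expsum.
rewrite /logratio; apply: measurable_funB => //.
by apply: measurableT_comp => //; apply: measurable_funB.
Qed.

(** Up to the factor - (1 - x), the sum with one more term is a primitive of the
    integrand: the derivative of [logratio x] is - 1 / (1 - v). The sum takes
    the value 1 at v = x, where [logratio x] vanishes. *)
Lemma integral_expsum_logratio j x u : u < x -> x < 1 ->
  (\int[lebesgue_measure]_(v in `[u, x])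
     ((1 - x) / (1 - v) * expsum j (logratio x v))%:E =
   ((1 - x) * (expsum j.+1 (logratio x u) - 1))%:E)%E.
Proof.
move=> ux x1.
pose F v := - (1 - x) *: expsum j.+1 (logratio x v).
have dF v : v <= x -> is_derive v 1 F ((1 - x) / (1 - v) * expsum j (logratio x v)).
  move=> vx.
  have v1 : v < 1 by exact: le_lt_trans x1.
  have H1 := @is_derive1_comp _ (expsum j.+1) (logratio x) _ _ _
    (expsum_is_derive j (logratio x v)) (is_derive_onem_ln (ln (1 - x)) v1).
  have H := is_deriveZ (- (1 - x)) H1.
  apply: (is_derive_eq H); rewrite /GRing.scale/=.
  by rewrite mulrN mulrNN mulrCA mulrC.
rewrite (@continuous_FTC2 _ _ F)//.
- rewrite /F /logratio subrr expsum_at0 -EFinB /GRing.scale/=.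
  by congr EFin; ring.
- apply: continuous_in_subspaceT => v; rewrite inE/= in_itv/= => /andP[_ vx].
  have v1 : v < 1 by exact: le_lt_trans x1.
  apply: cvgM; first (apply: cvgM; first exact: cvg_cst).
    apply: cvgV; first by rewrite subr_eq0 gt_eqF.
    by apply: cvgB; [exact: cvg_cst|exact: cvg_id].
  apply: (@continuous_comp _ _ _ (logratio x) (expsum j)).
    apply: differentiable_continuous; apply/derivable1_diffP.
    by have [] := is_derive_onem_ln (ln (1 - x)) v1.
  exact: continuous_expsum.
- have cF v : v <= x -> {for v, continuous F}.
    move=> vx; apply: differentiable_continuous; apply/derivable1_diffP.
    by have [] := dF _ vx.
  split.
  + by move=> v; rewrite in_itv/= => /andP[_ /ltW vx]; have [] := dF _ vx.
  + by apply: cvg_at_right_filter; exact: (cF _ (ltW ux)).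
  + by apply: cvg_at_left_filter; exact: (cF _ (lexx x)).
- move=> v; rewrite in_itv/= => /andP[_ /ltW vx].
  by rewrite derive1E; have [_ ->] := dF _ vx.
Qed.

End expsum.

(** * The tail of a record value *)

Section record_survival.
Context (R : realType).
Implicit Types x : R.

(** The value of P (U_n > x). At x = 1 the convention ln 0 = 0 is harmless,
    because the factor 1 - x vanishes. *)
Definition record_survival n x : R := (1 - x) * expsum n.+1 (- ln (1 - x)).

Definition record_gain n x : R :=
  (1 - x) * ((- ln (1 - x)) ^+ n.+1 / n.+1`!%:R).

Lemma record_survivalS n x :
  record_survival n.+1 x = record_survival n x + record_gain n x.
Proof. by rewrite /record_survival expsumS mulrDr. Qed.

Lemma neg_ln_onem_ge0 x : 0 <= x <= 1 -> 0 <= - ln (1 - x).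
Proof. by move=> /andP[x0 x1]; rewrite oppr_ge0 ln_le0// gerBl. Qed.

Lemma record_gain_ge0 n x : 0 <= x <= 1 -> 0 <= record_gain n x.
Proof.
move=> x01; have /andP[x0 x1] := x01.
by rewrite mulr_ge0 ?subr_ge0// divr_ge0// exprn_ge0// neg_ln_onem_ge0.
Qed.

Lemma record_survival_ge0 n x : 0 <= x <= 1 -> 0 <= record_survival n x.
Proof.
move=> x01; have /andP[x0 x1] := x01.
by rewrite mulr_ge0 ?subr_ge0// expsum_ge0// neg_ln_onem_ge0.
Qed.

Context (ds : measure_display) (S : measurableType ds).

Lemma measurable_fun_record_survival n (f : S -> R) : measurable_fun setT f ->
  measurable_fun setT (fun s => record_survival n (f s)).
Proof.
move=> mf; rewrite /record_survival; apply: measurable_funM.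
  exact: measurable_funB.
apply: measurableT_comp.
  by apply: continuous_measurable_fun; exact: continuous_expsum.
apply: measurableT_comp => //; apply: measurableT_comp => //.
exact: measurable_funB.
Qed.

Lemma measurable_fun_record_gain n (f : S -> R) : measurable_fun setT f ->
  measurable_fun setT (fun s => record_gain n (f s)).
Proof.
move=> mf; rewrite (_ : (fun s => _) = fun s =>
  record_survival n.+1 (f s) - record_survival n (f s)).
  by apply: measurable_funB; exact: measurable_fun_record_survival.
by apply/funext => s; rewrite record_survivalS addrAC subrr add0r.
Qed.

End record_survival.

(** * The chain of successive records *)

Section record_step.
Context (R : realType).
Implicit Types (x u v : R) (j : nat).

(** A state is the current record together with the number of records still
    awaited; when that number is 0 the state is frozen. Values of v outside
    (z.1, 1) are discarded, which keeps the record in [0, 1) on every path. *)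
Definition record_step (z : (R * nat) * R) : R * nat :=
  if [&& (0 < z.1.2)%N, z.1.1 < z.2 & z.2 < 1] then (z.2, z.1.2.-1) else z.1.

Lemma measurable_record_step : measurable_fun setT record_step.
Proof.
apply: measurable_fun_if => //.
- apply: measurable_and; last apply: measurable_and.
  + by apply: measurable_fun_ltn => //; apply: measurableT_comp.
  + by apply: measurable_fun_ltr => //; apply: measurableT_comp.
  + by apply: measurable_fun_ltr.
- apply: measurable_funTS; apply: measurable_fun_pair => //.
  by apply: measurableT_comp => //; apply: measurableT_comp.
- exact: measurable_funTS.
Qed.

Lemma measurable_fun_prod_nat d (T : measurableType d) (f : R * nat -> T) :
  (forall j, measurable_fun setT (fun u => f (u, j))) -> measurable_fun setT f.
Proof.
move=> mf _ B mB; rewrite setTI.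
rewrite (_ : f @^-1` B =
  \bigcup_j (((fun u => f (u, j)) @^-1` B) `*` [set j])); last first.
  apply/seteqP; split => [[u j] /= fB|[u j] [k _ [/= fB ->]]//].
  by exists j.
apply: bigcupT_measurable => j; apply: measurableX => //.
by rewrite -[X in measurable X]setTI; exact: mf.
Qed.

(** From the record z.1, the probability that the record reached after z.2 more
    records is above x. For z.2 = 0 the sum is empty and only the test
    x < z.1 remains. *)
Definition exceed_prob x (z : R * nat) : R :=
  if x < z.1 then 1
  else (1 - x) / (1 - z.1) * expsum z.2 (logratio x z.1).

Lemma measurable_exceed_prob x : measurable_fun setT (exceed_prob x).
Proof.
apply: measurable_fun_prod_nat => j; rewrite /exceed_prob /=.
apply: measurable_fun_if => //; first exact: measurable_fun_ltr.
apply: measurable_funTS; apply: measurable_funM.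
  apply: measurable_funM => //; apply: measurableT_comp => //.
  - exact: measurable_invr.
  - exact: measurable_funB.
exact: measurable_expsum_logratio.
Qed.

Lemma logratio_ge0 x u : u <= x -> x < 1 -> 0 <= logratio x u.
Proof.
move=> ux x1; have u1 := le_lt_trans ux x1.
by rewrite subr_ge0 ler_ln ?posrE ?subr_gt0// lerD2l lerN2.
Qed.

Lemma exceed_prob_ge0 x z : x < 1 -> 0 <= exceed_prob x z.
Proof.
move=> x1; rewrite /exceed_prob; case: ltP => // zx.
rewrite mulr_ge0 ?expsum_ge0 ?logratio_ge0//.
rewrite divr_ge0 ?subr_ge0// ltW//; exact: le_lt_trans x1.
Qed.

Lemma exceed_prob_self x j : x < 1 -> exceed_prob x (x, j.+1) = 1.
Proof.
move=> x1; rewrite /exceed_prob ltxx /logratio subrr expsum_at0 mulr1 divff//.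
by rewrite subr_eq0 gt_eqF.
Qed.

Lemma ge0_integral_itv_split (f : R -> \bar R) (a b c : R) : a <= b -> b <= c ->
  measurable_fun setT f -> (forall v, 0 <= f v)%E ->
  (\int[lebesgue_measure]_(v in `[a, c]) f v =
   \int[lebesgue_measure]_(v in `[a, b]) f v +
   \int[lebesgue_measure]_(v in `[b, c]) f v)%E.
Proof.
move=> ab bc mf f0.
rewrite (@itv_bndbnd_setU _ _ _ (BRight b)) ?bnd_simp// ge0_integral_setU//=.
- by rewrite integral_itv_obnd_cbnd//; exact: measurable_funTS.
- exact: measurable_funTS.
- apply/disj_setPS => v [/=]; rewrite !in_itv/= => /andP[_ vb] /andP[].
  by rewrite ltNge vb.
Qed.

(** The martingale property. The state is frozen when j = 0. When j > 0, the new
    value v leaves it unchanged if v <= u and otherwise becomes the record,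
    uniformly on (u, 1). If x <= u both outcomes have value 1. If u < x, the
    values v > x contribute 1 - x and those in (u, x) contribute an integral
    that lengthens the sum by one term. *)
Lemma integral_exceed_prob_step x u j : 0 <= x < 1 -> 0 <= u < 1 ->
  (\int[uniform_prob (@ltr01 R)]_v (exceed_prob x (record_step ((u, j), v)))%:E =
   (exceed_prob x (u, j))%:E)%E.
Proof.
move=> /andP[x0 x1] /andP[u0 u1].
have mh : measurable_fun setT (fun v => (exceed_prob x (record_step ((u, j), v)))%:E).
  apply/measurable_EFinP; apply: measurableT_comp; first exact: measurable_exceed_prob.
  by apply: measurableT_comp => //; exact: measurable_record_step.
have h0 v : (0 <= (exceed_prob x (record_step ((u, j), v)))%:E)%E.
  by rewrite lee_fin exceed_prob_ge0.
rewrite integral_uniform// subr0 invr1 mul1e.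
case: j mh h0 => [|j] mh h0.
  under eq_integral do rewrite /record_step /=.
  by rewrite integral_cst//= lebesgue_measure_itv/= lte_fin ltr01 -EFinD subr0 mule1.
set H := exceed_prob x (u, j.+1).
have mhr D : measurable_fun D (fun v => exceed_prob x (record_step ((u, j.+1), v))).
  by apply: measurable_funTS; apply/measurable_EFinP.
rewrite (ge0_integral_itv_split u0 (ltW u1)) //.
have piece1 : (\int[lebesgue_measure]_(v in `[0%R, u])
    (exceed_prob x (record_step ((u, j.+1), v)))%:E = (H * u)%:E)%E.
  rewrite (@eq_integral_itv_bounded _ _ _ (cst H)) => [|//|//|v]; last first.
    rewrite in_itv/= => /andP[_ vu].
    by rewrite /record_step/= ltNge (ltW vu).
  rewrite (_ : (fun _ => _) = cst H%:E)// integral_cst//=.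
  rewrite lebesgue_measure_itv/= lte_fin -EFinB subr0.
  case: ltP => // u0'; have -> : u = 0 by apply/le_anti; rewrite u0' u0.
  by rewrite mule0 mulr0.
rewrite piece1.
have piece3 y : u <= y -> x <= y -> y < 1 -> (\int[lebesgue_measure]_(v in `[y, 1%R])
    (exceed_prob x (record_step ((u, j.+1), v)))%:E = (1 - y)%:E)%E.
  move=> uy xy y1.
  rewrite (@eq_integral_itv_bounded _ _ _ (cst 1)) => [|//|//|v]; last first.
    rewrite in_itv/= => /andP[yv v1].
    rewrite /record_step/= (le_lt_trans uy yv) v1/= /exceed_prob/=.
    by rewrite (le_lt_trans xy yv).
  rewrite (_ : (fun _ => _) = cst 1%E)// integral_cst//= lebesgue_measure_itv/=.
  by rewrite lte_fin y1 -EFinB mul1e.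
have [xu|ux] := leP x u.
  rewrite piece3// -EFinD; congr EFin.
  have -> : H = 1.
    move: xu; rewrite le_eqVlt => /predU1P[xu|xu]; last by rewrite /H /exceed_prob/= xu.
    by rewrite /H -xu exceed_prob_self.
  by rewrite mul1r subrKC.
rewrite (ge0_integral_itv_split (ltW ux) (ltW x1))// piece3//; last exact: ltW.
rewrite (@eq_integral_itv_bounded _ _ _
  (fun v => (1 - x) / (1 - v) * expsum j (logratio x v))) => [|//| |v]; last 2 first.
- apply: measurable_funTS; apply: measurable_funM.
    apply: measurable_funM => //; apply: measurableT_comp => //.
      exact: measurable_invr.
    exact: measurable_funB.
  exact: measurable_expsum_logratio.
- rewrite in_itv/= => /andP[uv vx].
  rewrite /record_step/= uv (lt_trans vx x1)/= /exceed_prob/=.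
  by rewrite ltNge (ltW vx).
rewrite integral_expsum_logratio// -!EFinD; congr EFin.
rewrite /H /exceed_prob/= ltNge (ltW ux)/=; field.
by rewrite subr_eq0 gt_eqF.
Qed.

End record_step.

(** * Record times and record values of a sequence *)

Section uniform_prob01.
Context (R : realType).

Lemma uniform_prob01E (A : set R) : measurable A ->
  uniform_prob (@ltr01 R) A = lebesgue_measure (A `&` `[0, 1]).
Proof.
move=> mA; rewrite /uniform_prob integral_uniform_pdf.
rewrite (eq_integral (cst 1%E)).
  by rewrite integral_cst ?mul1e//; exact: measurableI.
move=> x; rewrite inE/= in_itv/= => -[_ x01].
by rewrite /uniform_pdf x01 subr0 invr1.
Qed.

Lemma uniform_prob01_le (v : R) : 0 <= v <= 1 ->
  uniform_prob (@ltr01 R) `]-oo, v] = v%:E.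
Proof.
move=> /andP[v0 v1]; rewrite uniform_prob01E//.
rewrite (_ : _ `&` _ = `[0, v]%classic).
  by rewrite lebesgue_measure_itv/= lte_fin -EFinB subr0; case: ltP => // v0';
    congr EFin; apply/le_anti; rewrite v0' v0.
apply/seteqP; split => y /=; rewrite !in_itv/=.
  by move=> [-> /andP[-> _]].
by move=> /andP[-> yv]; rewrite yv (le_trans yv v1).
Qed.

Lemma uniform_prob01_oo : uniform_prob (@ltr01 R) `]0, 1[ = 1%E.
Proof.
rewrite uniform_prob01E// (setIidl _).
  by rewrite lebesgue_measure_itv/= lte_fin ltr01 -EFinB subr0.
by move=> y /=; rewrite !in_itv/= => /andP[/ltW-> /ltW->].
Qed.

End uniform_prob01.

Section record_time.
Context (R : realType) (v : nat -> R).

Lemma next_record_timeP k : (exists m, (k < m)%N && (v k < v m)) ->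
  [/\ (k < next_record_time v k)%N, v k < v (next_record_time v k) &
      forall i, (k < i < next_record_time v k)%N -> v i <= v k].
Proof.
move=> ex; rewrite /next_record_time; case: pselect => // e.
case: ex_minnP => m /andP[km vm] minm; split => // i /andP[ki im].
rewrite leNgt; apply/negP => vi.
by have := minm i; rewrite ki vi => /(_ isT); rewrite leqNgt im.
Qed.

Lemma next_record_time_eqP k m : next_record_time v k = m <->
  ((k < m)%N /\ v k < v m /\ forall i, (k < i < m)%N -> ~ (v k < v i)) \/
  (m = k /\ forall i, (k < i)%N -> ~ (v k < v i)).
Proof.
split.
  move=> <-; have [e|ne] := pselect (exists m, (k < m)%N && (v k < v m)).
    left; have [? ? H] := next_record_timeP e; split => //; split => // i /H.
    by rewrite leNgt => /negP.
  right; rewrite /next_record_time; case: pselect => // ?; split => // i ki vi.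
  by apply: ne; exists i; rewrite ki.
move=> [[km [vm H]]|[-> H]].
  have e : exists m, (k < m)%N && (v k < v m) by exists m; rewrite km.
  have [h1 h2 h3] := next_record_timeP e.
  case: (ltngtP (next_record_time v k) m) => // lt.
    by exfalso; apply: (H (next_record_time v k)); rewrite ?h1.
  have := h3 m; rewrite km lt => /(_ isT).
  by rewrite leNgt vm.
rewrite /next_record_time; case: pselect => // e.
have [] := e => i /andP[ki vi]; exfalso; exact: (H i ki vi).
Qed.

End record_time.

Section measurable_record.
Context (R : realType) (d : measure_display)
    (Omega : measurableType d) (P : probability Omega R)
    (V : nat -> {RV P >-> R}).

Lemma measurable_next_record_time k m :
  measurable [set w | next_record_time (fun i => V i w) k = m].
Proof.
have -> : [set w | next_record_time (fun i => V i w) k = m] =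
  [set w | (k < m)%N] `&` ([set w | V k w < V m w] `&`
     \bigcap_(i in [set i | (k < i < m)%N]) ~` [set w | V k w < V i w]) `|`
  [set w | m = k] `&` \bigcap_(i in [set i | (k < i)%N]) ~` [set w | V k w < V i w].
  by apply/seteqP; split => w /= /next_record_time_eqP.
have mcst (Q : Prop) : measurable [set w : Omega | Q].
  by have [q|q] := pselect Q; [rewrite (_ : mkset _ = setT)|rewrite (_ : mkset _ = set0)];
    rewrite //; apply/seteqP; split.
have mlt i : measurable (~` [set w | V k w < V i w]).
  by apply: measurableC; exact: measurable_set_lt.
apply: measurableU; apply: measurableI => //.
- apply: measurableI; first exact: measurable_set_lt.
  exact: bigcap_measurableType.
- exact: bigcap_measurableType.
Qed.

Lemma measurable_record_time n m :
  measurable [set w | record_time (fun i => V i w) n = m].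
Proof.
elim: n m => [|n IH] m.
  rewrite /record_time/=; have [<-|/eqP m0] := eqVneq 0%N m.
    by rewrite (_ : mkset _ = setT)//; apply/seteqP; split.
  by rewrite (_ : mkset _ = set0)//; apply/seteqP; split.
have -> : [set w | record_time (fun i => V i w) n.+1 = m] =
  \bigcup_k ([set w | record_time (fun i => V i w) n = k] `&`
             [set w | next_record_time (fun i => V i w) k = m]).
  apply/seteqP; split => w /=; first by move=> E; exists (record_time (fun i => V i w) n).
  by move=> [k _ [<-]].
apply: bigcupT_measurable => k; apply: measurableI; first exact: IH.
exact: measurable_next_record_time.
Qed.

Lemma measurable_record_value n :
  measurable_fun setT (fun w => record_value (fun i => V i w) n).
Proof.
move=> _ B mB; rewrite setTI.
have -> : (fun w => record_value (fun i => V i w) n) @^-1` B =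
  \bigcup_k ([set w | record_time (fun i => V i w) n = k] `&` V k @^-1` B).
  apply/seteqP; split => w /=.
    by move=> Bw; exists (record_time (fun i => V i w) n).
  by move=> [k _ [<-]].
apply: bigcupT_measurable => k; apply: measurableI.
  exact: measurable_record_time.
exact: measurable_funPTI.
Qed.

End measurable_record.

(** * The law of the record values of a uniform sequence *)

Section record_law.
Context (R : realType) (d : measure_display)
    (Omega : measurableType d) (P : probability Omega R)
    (V : nat -> {RV P >-> R}) (hV : iid_uniform V).

Let indV : mutually_independent V := hV.1.
Let unifV i A : measurable A -> P (V i @^-1` A) = uniform_prob (@ltr01 R) A.
Proof. exact: hV.2. Qed.

Let mV i (A : set R) : measurable A -> measurable (V i @^-1` A).
Proof. by move=> mA; exact: measurable_funPTI. Qed.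

(** Along such a path every record is followed by another one, so no record time
    falls back on the default value of [next_record_time]. *)
Definition regular_path (v : nat -> R) :=
  (forall i, 0 < v i < 1) /\ forall k, exists m, (k < m)%N && (v k < v m).

(** By independence, M consecutive variables are all at most r < 1 with
    probability r^M, which tends to 0. *)
Let late_bounded_negligible k p :
  P.-negligible (\bigcap_(m in [set m | (k < m)%N])
    (V m @^-1` `]-oo, 1 - p.+1%:R^-1])).
Proof.
set r : R := 1 - _; set N := \bigcap_(m in _) _.
have r01 : 0 <= r <= 1.
  by rewrite subr_ge0 invf_le1 ?ler1n ?ltr0n//= gerBl invr_ge0 ler0n.
have [r0 r1] := andP r01.
have mN : measurable N by apply: bigcap_measurableType => m _; exact: mV.
have PN M : (P N <= (r ^+ M)%:E)%E.
  pose A := fun _ : nat => `]-oo, r]%classic.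
  have := @indV (iota k.+1 M) A (iota_uniq _ _) (fun=> measurable_itv _).
  rewrite (eq_big_seq (fun=> r%:E)); last first.
    by move=> i _; rewrite /A unifV// uniform_prob01_le.
  rewrite prodEFin big_const_seq count_predT size_iota -Monoid.iteropE => <-.
  apply: le_measure; rewrite ?inE//.
    by apply: bigcap_measurableType => i _; apply: mV; exact: measurable_itv.
  by move=> w Nw i /=; rewrite mem_iota => /andP[ki _]; exact: Nw.
exists N; split => //.
have fN : P N \is a fin_num by exact: fin_num_measure.
apply/eqP; rewrite eq_le measure_ge0 andbT -(fineK fN) lee_fin.
have rlt1 : `|r| < 1.
  by rewrite ger0_norm// gtrBl invr_gt0 ltr0n.
have cr := cvg_expr rlt1.
rewrite -(cvg_lim _ cr)//; apply: limr_ge; first by apply/cvg_ex; exists 0.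
by near=> M; rewrite -lee_fin fineK.
Unshelve. all: by end_near. Qed.

Lemma regular_path_ae : {ae P, forall w, regular_path (fun i => V i w)}.
Proof.
have h1 : {ae P, forall w, forall i, 0 < V i w < 1}.
  apply: ae_foralln => i.
  exists (~` (V i @^-1` `]0, 1[)); split.
  - by apply: measurableC; exact: mV.
  - rewrite [LHS](probability_setC P); last exact: mV.
    by rewrite [X in (1 - X)%E]unifV// uniform_prob01_oo subee.
  - by move=> w /= h; rewrite in_itv.
have h2 : {ae P, forall w, forall k p, exists m, (k < m)%N && (1 - p.+1%:R^-1 < V m w)}.
  apply: ae_foralln => k; apply: ae_foralln => p.
  apply: negligibleS (late_bounded_negligible k p) => w /= h m /= km.
  rewrite in_itv/= leNgt; apply/negP => Vm.
  by apply: h; exists m; rewrite km.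
apply: filterS2 h1 h2 => w w01 wsup; split => // k.
have /andP[_ Vk1] := w01 k.
have [p /ltW Hp] := ltr_add_invr Vk1.
have [m /andP[km Vm]] := wsup k p.
by exists m; rewrite km (le_lt_trans _ Vm)// lerBrDr.
Qed.

Let st n := chain V (@record_step R) (0, n.+1).

Let stS n k w : st n k.+1 w = record_step (st n k w, V k w).
Proof. by []. Qed.

Lemma chain_range n k w : 0 <= (st n k w).1 < 1.
Proof.
elim: k => [|k]; first by rewrite /= lexx ltr01.
rewrite stS /record_step; case: ifP => //= /and3P[_ uv v1] /andP[u0 _].
by rewrite v1 (le_trans u0 (ltW uv)).
Qed.

Lemma chain_count n k w : ((st n k w).2 <= n.+1)%N.
Proof.
elim: k => [|k] //.
rewrite stS /record_step; case: ifP => //= _ h.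
exact: leq_trans (leq_pred _) h.
Qed.

(** The chain starts from the fictitious record 0 with n.+1 records awaited, so
    V_0 is the first one. Between two record times nothing exceeds the current
    record, and the state does not move. *)
Lemma chain_at_record n w j : regular_path (fun i => V i w) -> (j <= n)%N ->
  st n (record_time (fun i => V i w) j).+1 w =
  (record_value (fun i => V i w) j, (n - j)%N).
Proof.
move=> [w01 wsup]; elim: j => [|j IH] jn.
  rewrite /st/= /record_step/= /record_value/record_time/=.
  by have /andP[-> ->] := w01 0%N; rewrite subn0.
have {IH}E := IH (ltnW jn).
set v := fun i => V i w in E *.
set k := record_time v j in E *.
have [kk' vk' between] := next_record_timeP (wsup k).
have -> : record_time v j.+1 = next_record_time v k by [].
set k' := next_record_time v k in kk' vk' between *.
have stay i : (k <= i < k')%N -> st n i.+1 w = (v k, (n - j)%N).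
  elim: i => [|i IH] /andP[ki ik'].
    by move: ki; rewrite leqn0 => /eqP k0; have -> : 1%N = k.+1 by rewrite k0.
  move: ki; rewrite leq_eqVlt => /predU1P[<-//|ki].
  have := IH; rewrite -ltnS ki (ltnW ik') => /(_ isT) Ei.
  rewrite stS Ei /record_step/=.
  have : V i.+1 w <= v k by apply: between; rewrite ki ik'.
  by rewrite leNgt => /negbTE ->; rewrite andbF.
have E' : st n k' w = (v k, (n - j)%N).
  move: (stay k'.-1); rewrite (ltn_predK kk'); apply.
  by rewrite leqnn andbT -ltnS (ltn_predK kk').
have /andP[_ v1] := w01 k'.
rewrite -[LHS]/(record_step (st n k' w, V k' w)) E' /record_step/= subn_gt0 jn.
by rewrite vk' v1/= subnS.
Qed.

Lemma chain_eventually n w : regular_path (fun i => V i w) ->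
  \forall k \near \oo, st n k w = (record_value (fun i => V i w) n, 0%N).
Proof.
move=> reg; exists (record_time (fun i => V i w) n).+1 => // k /= nk.
rewrite -(subnK nk); elim: (k - _)%N => [|i IH].
  by rewrite add0n chain_at_record// subnn.
by rewrite addSn stS IH.
Qed.

(** The law of V_i and the uniform law live on two copies of the Borel sets of
    the reals that carry different displays; the identity map transports one to
    the other. *)
Let integral_uniform_RV i (f : R -> \bar R) :
  measurable_fun setT f -> (forall v, 0 <= f v)%E ->
  (\int[distribution P (V i)]_v f v = \int[uniform_prob (@ltr01 R)]_v f v)%E.
Proof.
move=> mf f0.
pose idR : {mfun measurableTypeR R >-> R} :=
  HB.pack (idfun : measurableTypeR R -> R)
    (isMeasurableFun.Build _ _ _ _ (idfun : measurableTypeR R -> R)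
       (@measurable_id _ _ setT)).
have unifE (A : set R) : measurable A -> A `<=` setT ->
    distribution P (V i) A = distribution (uniform_prob (@ltr01 R)) idR A.
  by move=> mA _; exact: hV.2.
rewrite (eq_measure_integral _ unifE).
by rewrite ge0_integral_pushforward//; move=> z _; exact: f0.
Qed.

Let integral_exceed_prob_chain x n k : 0 <= x < 1 ->
  (\int[P]_w (exceed_prob x (st n k w))%:E = (exceed_prob x (0%R, n.+1))%:E)%E.
Proof.
move=> /andP[x0 x1]; elim: k => [|k IH].
  by rewrite /= (_ : (fun _ => _) = cst (exceed_prob x (0, n.+1))%:E)// integral_cst//=
    probability_setT mule1.
rewrite /st (integral_chain_step (@measurable_record_step R) (0, n.+1) indV k
  (h := fun z => (exceed_prob x z)%:E)); last 2 first.
- by apply/measurable_EFinP; exact: measurable_exceed_prob.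
- by move=> z; rewrite lee_fin exceed_prob_ge0.
rewrite -IH; apply: eq_integral => w _.
rewrite integral_uniform_RV; last 2 first.
- apply/measurable_EFinP; apply: measurableT_comp; first exact: measurable_exceed_prob.
  by apply: measurableT_comp; first exact: measurable_record_step.
- by move=> z; rewrite lee_fin exceed_prob_ge0.
have := chain_range n k w; rewrite /st; case: (chain _ _ _ _ _) => u j u01.
by rewrite integral_exceed_prob_step// x0.
Qed.

Lemma exceed_prob_start (x : R) n : 0 <= x ->
  exceed_prob x (0, n.+1) = record_survival n x.
Proof.
move=> x0; rewrite /exceed_prob/= ltNge x0/= /logratio subr0 divr1 ln1 sub0r.
by [].
Qed.

(** A crude bound, uniform along the chain, for dominated convergence. *)
Lemma exceed_prob_bound (x : R) n z : 0 <= x < 1 -> 0 <= z.1 < 1 -> (z.2 <= n)%N ->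
  exceed_prob x z <= 1 + expsum n (logratio x 0).
Proof.
move=> /andP[x0 x1] /andP[u0 u1] jn; rewrite /exceed_prob.
have L0 := logratio_ge0 x0 x1.
case: ltP => [_|ux]; first by rewrite lerDl expsum_ge0.
have l0 := logratio_ge0 ux x1.
rewrite -[leLHS]add0r lerD// -[leRHS]mul1r ler_pM ?expsum_ge0//.
- by rewrite divr_ge0 ?subr_ge0 ?ltW//.
- by rewrite ler_pdivrMr ?subr_gt0// mul1r lerD2l lerN2.
- apply: (le_trans (expsum_le _ (z := logratio x 0) _)) (expsum_homo L0 jn).
  rewrite l0 /logratio lerD2r ler_ln ?posrE ?subr_gt0// subr0.
  by rewrite gerBl.
Qed.

(** The expectation of [exceed_prob x] along the chain is constant, equal to its
    initial value. Almost surely the chain stops at (U_n, 0), where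
    [exceed_prob x] is the indicator of U_n > x, and dominated convergence
    identifies the constant with P (U_n > x). The level x = 1 is apart: no
    record value exceeds it. *)
Theorem record_value_survival n (x : R) : 0 <= x <= 1 ->
  P [set w | x < record_value (fun i => V i w) n] = (record_survival n x)%:E.
Proof.
move=> /andP[x0]; rewrite le_eqVlt => /predU1P[->|x1].
  rewrite /record_survival subrr mul0r.
  have mS : measurable [set w | 1 < record_value (fun i => V i w) n].
    by apply: measurable_set_lt => //; exact: measurable_record_value.
  have : P.-negligible [set w | 1 < record_value (fun i => V i w) n].
    apply: negligibleS regular_path_ae => w /= h [reg _].
    have /andP[_] := reg (record_time (fun i => V i w) n).
    by rewrite ltNge (ltW h).
  by move/measure_negligible; exact.
have x01 : 0 <= x < 1 by rewrite x0.
set S := [set w | _].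
have mS : measurable S.
  by apply: measurable_set_lt => //; exact: measurable_record_value.
pose f_ k w := (exceed_prob x (st n k w))%:E.
pose f w : \bar R := (\1_S w)%:E.
pose C := 1 + expsum n.+1 (logratio x 0).
have C0 : 0 <= C by rewrite addr_ge0// expsum_ge0// logratio_ge0.
have mf_ k : measurable_fun setT (f_ k).
  apply/measurable_EFinP; apply: measurableT_comp; first exact: measurable_exceed_prob.
  exact: (measurable_chain V (@measurable_record_step R) (0, n.+1) k).
have mf : measurable_fun setT f by apply/measurable_EFinP; exact: measurable_indic.
have f_f : {ae P, forall w, setT w -> f_ ^~ w @ \oo --> f w}.
  apply: filterS regular_path_ae => w reg _.
  apply: cvg_near_cst; apply: filterS (chain_eventually n reg) => k Ek.
  rewrite /f_ Ek /exceed_prob/= /f indicE.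
  case: ltP => xU; first by rewrite mem_set.
  rewrite memNset; first by rewrite /expsum big_ord0 mulr0.
  by rewrite /S/= ltNge xU.
have iC : P.-integrable setT (cst C%:E) by exact: finite_measure_integrable_cst.
have f_C : {ae P, forall w k, setT w -> (`|f_ k w| <= (cst C%:E) w)%E}.
  apply: aeW => w k _; rewrite /f_ /= ger0_norm ?exceed_prob_ge0// lee_fin.
  exact: (exceed_prob_bound x01 (chain_range n k w) (chain_count n k w)).
have [_ _] := dominated_convergence measurableT mf_ mf f_f iC f_C.
have -> : [sequence (\int[P]_w f_ k w)%E]_k = cst (record_survival n x)%:E.
  by apply/funext => k /=; rewrite integral_exceed_prob_chain// exceed_prob_start.
rewrite /f integral_indic// setIT => H.
have Hc : (cst (record_survival n x)%:E : nat -> \bar R) @ \oo -->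
  (record_survival n x)%:E by exact: cvg_cst.
by rewrite (cvg_unique _ H Hc).
Qed.

End record_law.

(** * Expected masses below and above a record value *)

Section record_tonelli.
Context (R : realType) (d : measure_display)
    (Omega : measurableType d) (P : probability Omega R)
    (V : nat -> {RV P >-> R}) (hV : iid_uniform V).
Context (ds : measure_display) (S : measurableType ds)
    (mu : {sigma_finite_measure set S -> \bar R})
    (a : S -> R) (ma : measurable_fun setT a) (a01 : forall s, 0 <= a s <= 1).

Let U n w := record_value (fun i => V i w) n.
Let mU n : measurable_fun setT (U n).
Proof. exact: measurable_record_value. Qed.

(** The functions a and phi play the role of a level and of a density with
    respect to mu. *)
Definition mass_below (phi : S -> R) (u : R) : \bar R :=
  (\int[mu]_s (phi s * (a s < u)%R%:R)%:E)%E.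

Definition mass_above (phi : S -> R) (u : R) : \bar R :=
  (\int[mu]_s (phi s * (u <= a s)%R%:R)%:E)%E.

Section one_weight.
Context (phi : S -> R) (mphi : measurable_fun setT phi)
  (phi0 : forall s, 0 <= phi s).

Let mbelow2 d' (T : measurableType d') (X : T -> R) :
  measurable_fun setT X ->
  measurable_fun setT (fun z : T * S => (phi z.2 * (a z.2 < X z.1)%R%:R)%:E).
Proof.
move=> mX; apply/measurable_EFinP; apply: measurable_funM.
  by apply: measurableT_comp.
apply: measurable_natr_bool; apply: measurable_fun_ltr; exact: measurableT_comp.
Qed.

Let mabove2 d' (T : measurableType d') (X : T -> R) :
  measurable_fun setT X ->
  measurable_fun setT (fun z : T * S => (phi z.2 * (X z.1 <= a z.2)%R%:R)%:E).
Proof.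
move=> mX; apply/measurable_EFinP; apply: measurable_funM.
  by apply: measurableT_comp.
apply: measurable_natr_bool; apply: measurable_fun_ler; exact: measurableT_comp.
Qed.

Lemma mass_below_ge0 u : (0 <= mass_below phi u)%E.
Proof. by apply: integral_ge0 => s _; rewrite lee_fin mulr_ge0. Qed.

Lemma mass_above_ge0 u : (0 <= mass_above phi u)%E.
Proof. by apply: integral_ge0 => s _; rewrite lee_fin mulr_ge0. Qed.

Lemma measurable_mass_below : measurable_fun setT (mass_below phi).
Proof.
apply: (@measurable_fun_fubini_tonelli_F _ _ _ _ _ mu
  (fun z : R * S => (phi z.2 * (a z.2 < z.1)%R%:R)%:E)).
  by apply: (@mbelow2 _ _ idfun); exact: measurable_id.
by move=> z; rewrite lee_fin mulr_ge0.
Qed.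

Lemma measurable_mass_above : measurable_fun setT (mass_above phi).
Proof.
apply: (@measurable_fun_fubini_tonelli_F _ _ _ _ _ mu
  (fun z : R * S => (phi z.2 * (z.1 <= a z.2)%R%:R)%:E)).
  by apply: (@mabove2 _ _ idfun); exact: measurable_id.
by move=> z; rewrite lee_fin mulr_ge0.
Qed.

Let mset_lt n x : measurable [set w | x < record_value (fun i => V i w) n].
Proof. by apply: measurable_set_lt => //; exact: mU. Qed.

(** Tonelli: for a fixed point s the expectation of the test a(s) < U_n is the
    tail of U_n at the level a(s). *)
Lemma integral_mass_below n :
  (\int[P]_w mass_below phi (U n w) =
   \int[mu]_s (phi s * record_survival n (a s))%:E)%E.
Proof.
rewrite /mass_below (fubini_tonelli
  (fun z : Omega * S => (phi z.2 * (a z.2 < U n z.1)%R%:R)%:E))/=; last 2 first.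
- exact: (@mbelow2 _ _ (U n)).
- by move=> z; rewrite lee_fin mulr_ge0.
apply: eq_integral => s _.
under eq_integral do rewrite EFinM.
rewrite ge0_integralZl_EFin//; last first.
  apply/measurable_EFinP; apply: measurable_natr_bool.
  exact: measurable_fun_ltr.
rewrite EFinM; congr (_ * _)%E.
rewrite -(record_value_survival hV n (a01 s)) -/(U n _).
rewrite -[RHS]mul1e -[in RHS](setIT [set w | _]) -integral_indic ?mul1e//.
  apply: eq_integral => w _; rewrite indicE; congr ((nat_of_bool _)%:R%:E).
  by apply/idP/idP; rewrite inE.
Qed.

Let measurable_weight (f : S -> R) : measurable_fun setT f ->
  measurable_fun setT (fun s => (phi s * f s)%:E).
Proof. by move=> mf; apply/measurable_EFinP; apply: measurable_funM. Qed.

Lemma integral_mass_above n :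
  (\int[P]_w mass_above phi (U n w) =
   \int[mu]_s (phi s * (1 - record_survival n (a s)))%:E)%E.
Proof.
rewrite /mass_above (fubini_tonelli
  (fun z : Omega * S => (phi z.2 * (U n z.1 <= a z.2)%R%:R)%:E))/=; last 2 first.
- exact: (@mabove2 _ _ (U n)).
- by move=> z; rewrite lee_fin mulr_ge0.
apply: eq_integral => s _.
under eq_integral do rewrite EFinM.
rewrite ge0_integralZl_EFin//; last first.
  apply/measurable_EFinP; apply: measurable_natr_bool.
  exact: measurable_fun_ler.
rewrite EFinM; congr (_ * _)%E.
rewrite EFinB -(record_value_survival hV n (a01 s)) -/(U n _).
rewrite -probability_setC; last exact: mset_lt.
rewrite -[in RHS](setIT (~` _)) -integral_indic//.
  apply: eq_integral => w _; rewrite indicE; congr ((nat_of_bool _)%:R%:E).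
  by apply/idP/idP; rewrite inE/= leNgt => /negP.
by apply: measurableC; exact: mset_lt.
Qed.

Lemma record_survival_le1 n (x : R) : 0 <= x <= 1 -> record_survival n x <= 1.
Proof.
move=> x01; rewrite -lee_fin -(record_value_survival hV n x01).
by rewrite probability_le1//; exact: mset_lt.
Qed.

Lemma integral_mass_belowS n :
  (\int[P]_w mass_below phi (U n.+1 w) = \int[P]_w mass_below phi (U n w) +
   \int[mu]_s (phi s * record_gain n (a s))%:E)%E.
Proof.
rewrite !integral_mass_below -ge0_integralD//.
- by apply: eq_integral => s _; rewrite record_survivalS mulrDr.
- by move=> s _; rewrite lee_fin mulr_ge0 ?record_survival_ge0.
- exact/measurable_weight/measurable_fun_record_survival.
- by move=> s _; rewrite lee_fin mulr_ge0 ?record_gain_ge0.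
- exact/measurable_weight/measurable_fun_record_gain.
Qed.

Lemma integral_mass_aboveS n :
  (\int[P]_w mass_above phi (U n w) = \int[P]_w mass_above phi (U n.+1 w) +
   \int[mu]_s (phi s * record_gain n (a s))%:E)%E.
Proof.
have m1S k : measurable_fun setT (fun s => (phi s * (1 - record_survival k (a s)))%:E).
  apply: measurable_weight; apply: measurable_funB => //.
  exact: measurable_fun_record_survival.
rewrite !integral_mass_above -ge0_integralD//.
- apply: eq_integral => s _; rewrite record_survivalS -EFinD -mulrDr.
  by congr (_ * _)%:E; ring.
- by move=> s _; rewrite lee_fin mulr_ge0 ?subr_ge0 ?record_survival_le1.
- by move=> s _; rewrite lee_fin mulr_ge0 ?record_gain_ge0.
- exact/measurable_weight/measurable_fun_record_gain.
Qed.
End one_weight.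
End record_tonelli.

Section record_expectation.
Context (R : realType) (d : measure_display)
    (Omega : measurableType d) (P : probability Omega R)
    (V : nat -> {RV P >-> R}) (hV : iid_uniform V).
Context (ds : measure_display) (S : measurableType ds)
    (mu : {sigma_finite_measure set S -> \bar R})
    (a : S -> R) (ma : measurable_fun setT a) (a01 : forall s, 0 <= a s <= 1).
Context (phi psi : S -> R) (mphi : measurable_fun setT phi)
  (mpsi : measurable_fun setT psi)
  (phi0 : forall s, 0 <= phi s) (psi0 : forall s, 0 <= psi s).

Let U n w := record_value (fun i => V i w) n.
Let mU n : measurable_fun setT (U n).
Proof. exact: measurable_record_value. Qed.
Let Up := mass_below mu a phi.
Let Dn := mass_above mu a psi.

Context (Q : R -> R)
  (QE : forall u, 0 < u < 1 -> (Q u)%:E = (Up u - Dn u)%E).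

(** Almost surely U_n lies in (0, 1), where Q is the difference of the two
    masses, and both masses of U_n are integrable. *)
Lemma record_expectationE n :
  measurable_fun setT (fun w => Q (U n w)) ->
  (\int[P]_w Up (U n w) < +oo)%E ->
  (\int[P]_w Dn (U n w) < +oo)%E ->
  P.-integrable setT (fun w => (Q (U n w))%:E) /\
  (\int[P]_w (Q (U n w))%:E = \int[P]_w Up (U n w) - \int[P]_w Dn (U n w))%E.
Proof.
move=> mQ Upoo Dnoo.
have Up0 u : (0 <= Up u)%E by exact: mass_below_ge0.
have Dn0 u : (0 <= Dn u)%E by exact: mass_above_ge0.
have iUp : P.-integrable setT (fun w => Up (U n w)).
  apply/integrableP; split.
    by apply: measurableT_comp (mU n); exact: measurable_mass_below.
  by under eq_integral do rewrite gee0_abs//.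
have iDn : P.-integrable setT (fun w => Dn (U n w)).
  apply/integrableP; split.
    by apply: measurableT_comp (mU n); exact: measurable_mass_above.
  by under eq_integral do rewrite gee0_abs//.
have iB := integrableB measurableT iUp iDn.
have eqQ : {ae P, forall w, setT w -> (Q (U n w))%:E = (Up (U n w) - Dn (U n w))%E}.
  by apply: filterS (regular_path_ae hV) => w [reg _] _; apply: QE; exact: reg.
have mEQ : measurable_fun setT (fun w => (Q (U n w))%:E) by exact/measurable_EFinP.
have mB := measurable_int P iB.
split; last first.
  by rewrite (ae_eq_integral _ _ measurableT mEQ mB eqQ) integralB.
apply/integrableP; split => //.
have /integrableP[_] := iB; apply: le_lt_trans.
pose B w := (Up (U n w) - Dn (U n w))%E.
rewrite (@ae_eq_integral _ _ _ _ setT (abse \o B))//.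
- exact: measurableT_comp.
- exact: measurableT_comp.
- by apply: filterS eqQ => w h tw; exact: (congr1 abse (h tw)).
Qed.

Let gain n := (\int[mu]_s ((phi s + psi s) * record_gain n (a s))%:E)%E.

Let gainD n : gain n = (\int[mu]_s (phi s * record_gain n (a s))%:E +
                        \int[mu]_s (psi s * record_gain n (a s))%:E)%E.
Proof.
have mw (f : S -> R) : measurable_fun setT f ->
    measurable_fun setT (fun s => (f s * record_gain n (a s))%:E).
  move=> mf; apply/measurable_EFinP; apply: measurable_funM => //.
  exact: measurable_fun_record_gain.
rewrite -ge0_integralD//.
- by apply: eq_integral => s _; rewrite mulrDl.
- by move=> s _; rewrite lee_fin mulr_ge0 ?record_gain_ge0.
- exact: mw.
- by move=> s _; rewrite lee_fin mulr_ge0 ?record_gain_ge0.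
- exact: mw.
Qed.

(** Passing from U_n to U_(n+1) raises the mass below by the integral of
    [record_gain] against phi and lowers the mass above by its integral against
    psi, so the two contributions add up. *)
Lemma record_expectation_increment n :
  (forall k, measurable_fun setT (fun w => Q (U k w))) ->
  (forall k, \int[P]_w Up (U k w) < +oo)%E ->
  (forall k, \int[P]_w Dn (U k w) < +oo)%E ->
  (\int[P]_w (Q (U n.+1 w))%:E = \int[P]_w (Q (U n w))%:E + gain n)%E.
Proof.
move=> mQ Upoo Dnoo.
have [_ ->] := record_expectationE (mQ n) (Upoo n) (Dnoo n).
have [_ ->] := record_expectationE (mQ n.+1) (Upoo n.+1) (Dnoo n.+1).
have fin k : (\int[P]_w Up (U k w))%E \is a fin_num.
  by rewrite ge0_fin_numE ?Upoo//; apply: integral_ge0 => w _; exact: mass_below_ge0.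
have find k : (\int[P]_w Dn (U k w))%E \is a fin_num.
  by rewrite ge0_fin_numE ?Dnoo//; apply: integral_ge0 => w _; exact: mass_above_ge0.
have := integral_mass_aboveS hV mu ma a01 mpsi psi0 n.
have := integral_mass_belowS hV mu ma a01 mphi phi0 n.
rewrite gainD.
move: (fin n) (fin n.+1) (find n) (find n.+1); rewrite /U /Up /Dn.
case: (\int[P]_w _)%E => // p0 _; case: (\int[P]_w _)%E => // p1 _.
case: (\int[P]_w _)%E => // d0 _; case: (\int[P]_w _)%E => // d1 _.
case: (\int[mu]_s (phi s * _)%:E)%E => // g1 [->].
case: (\int[mu]_s (psi s * _)%:E)%E => // g2 [->].
by congr EFin; ring.
Qed.
End record_expectation.

(** * Probability measures with a density *)

Section density_prob.
Context (R : realType) (ds : measure_display) (S : measurableType ds)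
    (mu : {sigma_finite_measure set S -> \bar R})
    (D : S -> R) (mD : measurable_fun setT D) (D0 : forall s, 0 <= D s)
    (D1 : (\int[mu]_s (D s)%:E = 1)%E).

Definition density_prob (A : set S) : \bar R := (\int[mu]_(s in A) (D s)%:E)%E.

Let density0 : density_prob set0 = 0%E.
Proof. by rewrite /density_prob integral_set0. Qed.

Let density_ge0 A : (0 <= density_prob A)%E.
Proof. by apply: integral_ge0 => s _; rewrite lee_fin. Qed.

Let mDE A : measurable_fun A (fun s => (D s)%:E).
Proof. by apply: measurable_funTS; exact/measurable_EFinP. Qed.

Let density_sigma_additive : semi_sigma_additive density_prob.
Proof.
move=> /= F mF tF mUF; rewrite /density_prob; apply: cvg_toP.
  apply: ereal_nondecreasing_is_cvgn => m n mn.
  apply: lee_sum_nneg_natr => // k _ _; exact: density_ge0.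
by rewrite ge0_integral_bigcup//= => s _; rewrite lee_fin.
Qed.

HB.instance Definition _ := isMeasure.Build _ _ _ density_prob
  density0 density_ge0 density_sigma_additive.

Let density_setT : density_prob setT = 1%E.
Proof. exact: D1. Qed.

HB.instance Definition _ := @Measure_isProbability.Build _ _ R
  density_prob density_setT.

Let density_dominated : density_prob `<< mu.
Proof.
apply/null_content_dominatesP => A mA muA0; rewrite /density_prob.
by apply: null_set_integral.
Qed.

(** The given density agrees almost everywhere with the Radon-Nikodym
    derivative, for which the change of variables is known. *)
Lemma ge0_integral_density_prob (f : S -> \bar R) :
  measurable_fun setT f -> (forall s, 0 <= f s)%E ->
  (\int[density_prob]_s f s = \int[mu]_s (f s * (D s)%:E))%E.
Proof.
move=> mf f0.
rewrite -(Radon_Nikodym_SigmaFinite.change_of_variables density_dominated)//.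
have iRN := Radon_Nikodym_SigmaFinite.f_integrable density_dominated.
apply: ae_eq_integral => //.
- by apply: emeasurable_funM => //; exact: measurable_int iRN.
- by apply: emeasurable_funM => //; exact: mDE.
- apply: ae_eqe_mul2l; apply: integral_ae_eq => // E _ mE.
  by rewrite -Radon_Nikodym_SigmaFinite.f_integral.
Qed.

(** An existential form, which hides the proofs on which the structure of
    probability measure on [density_prob] depends. *)
Lemma density_probP : exists P : probability S R, forall f : S -> \bar R,
  measurable_fun setT f -> (forall s, 0 <= f s)%E ->
  (\int[P]_s f s = \int[mu]_s (f s * (D s)%:E))%E.
Proof.
exists density_prob; exact: ge0_integral_density_prob.
Qed.

End density_prob.

(** * The left-continuous inverse of a distribution function *)

Section quantile.
Context (R : realType) (d : measure_display) (Omega : measurableType d)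
  (P : probability Omega R) (X : {RV P >-> R}).

Let F x := fine (cdf X x).
Let Q := Defs.left_inverse (cdf X).

Let mX (A : set R) : measurable A -> measurable (X @^-1` A).
Proof. by move=> mA; exact: measurable_funPTI. Qed.

Lemma cdf_fineK x : (F x)%:E = cdf X x.
Proof. by rewrite /F fineK// fin_num_measure. Qed.

Lemma fine_cdf01 x : 0 <= F x <= 1.
Proof. by rewrite -!lee_fin cdf_fineK cdf_ge0 cdf_le1. Qed.

Lemma fine_cdf_nondecreasing : nondecreasing_fun F.
Proof. by move=> x y xy; rewrite -lee_fin !cdf_fineK cdf_nondecreasing. Qed.

Lemma cdf_right_approx x u : (forall y, x < y -> u <= F y) -> u <= F x.
Proof.
move=> H; have cF : F y @[y --> x^'+] --> F x.
  by apply: fine_cvg; rewrite cdf_fineK; exact: cdf_right_continuous.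
rewrite -(cvg_lim _ cF)//; apply: limr_ge; first by apply/cvg_ex; exists (F x).
by near=> y; apply: H.
Unshelve. all: by end_near. Qed.

Lemma cdf_large u : u < 1 -> exists x, u <= F x.
Proof.
move=> u1; have cF : F y @[y --> +oo] --> (1 : R).
  by apply: fine_cvg; exact: cvg_cdfy1.
have /cvgr_ge/(_ _ u1) := cF => near_u.
by have [y] := filter_ex near_u; exists y.
Qed.

Lemma cdf_small u : 0 < u -> exists x, F x < u.
Proof.
move=> u0; have cF : F y @[y --> -oo] --> (0 : R).
  by apply: fine_cvg; exact: cvg_cdfNy0.
have /cvgr_lt/(_ _ u0) := cF => near_u.
by have [y] := filter_ex near_u; exists y.
Qed.

(** The Galois connection between a distribution function and its inverse. The
    limits of F at both ends make the infimum meaningful for 0 < u < 1, and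
    right continuity of F makes it attained. *)
Lemma left_inverse_cdf_le u x : 0 < u < 1 -> (Q u <= x) = (u <= F x).
Proof.
move=> /andP[u0 u1]; rewrite /Q /Defs.left_inverse.
set A := [set x | _].
have AE y : A y <-> u <= F y by rewrite /A/= -cdf_fineK lee_fin.
have [y0 Fy0] := cdf_large u1; have [y1 Fy1] := cdf_small u0.
have lbA : lbound A y1.
  move=> y /AE uF; rewrite leNgt; apply/negP => /ltW /fine_cdf_nondecreasing yy1.
  by have := lt_le_trans Fy1 (le_trans uF yy1); rewrite ltxx.
have infA : has_inf A by split; [exists y0; exact/AE | exists y1].
apply/idP/idP => [Qx|uF]; last by apply: ge_inf; [exists y1|exact/AE].
apply: cdf_right_approx => y xy.
have [z /AE uz zy] := inf_lt infA.1 (le_lt_trans Qx xy).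
exact: le_trans uz (fine_cdf_nondecreasing (ltW zy)).
Qed.

Lemma left_inverse_cdf_const c : P [set w | X w = c] = 1%E ->
  forall u, 0 < u < 1 -> Q u = c.
Proof.
move=> Pc u u01; have /andP[u0 u1] := u01.
have mc : measurable [set w | X w = c] by exact: (@mX [set c] _).
apply/eqP; rewrite eq_le; apply/andP; split.
  rewrite left_inverse_cdf_le// (le_trans (ltW u1))// -lee_fin cdf_fineK -Pc.
  apply: le_measure; rewrite ?inE//; first exact: mX.
  by move=> w /= ->; rewrite in_itv/=.
rewrite leNgt; apply/negP => Qc.
suff F0 : F (Q u) = 0.
  by have := lexx (Q u); rewrite left_inverse_cdf_le// F0 leNgt u0.
apply/le_anti; rewrite (andP (fine_cdf01 _)).1 andbT -lee_fin cdf_fineK.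
have PcC : P (~` [set w | X w = c]) = 0%:E by rewrite probability_setC// Pc subee.
rewrite -[leRHS]PcC -[leLHS]/(P (X @^-1` `]-oo, Q u])).
apply: le_measure; rewrite ?inE//; [exact: mX|exact: measurableC|].
move=> w /=; rewrite in_itv/= => XQ Xc.
by move: (le_lt_trans XQ Qc); rewrite Xc ltxx.
Qed.

(** If F took only the values 0 and 1, it would jump from 0 to 1 at its median c,
    and X would equal c almost surely. *)
Lemma non_degenerate_cdf : non_degenerate X -> exists x, 0 < F x < 1.
Proof.
move=> ndX; apply: contrapT => H; apply: ndX.
have F01 x : F x < 1 -> F x = 0.
  move=> Fx1; apply/le_anti; rewrite (andP (fine_cdf01 _)).1 andbT leNgt.
  by apply/negP => Fx0; apply: H; exists x; rewrite Fx0.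
have half : 0 < (2^-1 : R) < 1 by lra.
pose c := Q 2^-1; exists c.
have Fc : F c = 1.
  have : 2^-1 <= F c by rewrite -left_inverse_cdf_le.
  have [/F01 ->|F1 _] := ltP (F c) 1; first by lra.
  by apply/le_anti; rewrite (andP (fine_cdf01 _)).2 F1.
have Flt x : x < c -> F x = 0.
  rewrite ltNge left_inverse_cdf_le// -ltNge => Fx; apply: F01; lra.
have PltC : P (X @^-1` `]-oo, c[) = 0%E.
  apply: measure_negligible; first exact: mX.
  apply: (@negligibleS _ _ _ _ (\bigcup_n X @^-1` `]-oo, c - n.+1%:R^-1])).
    move=> w /=; rewrite in_itv/= => Xc; have [n nX] := ltr_add_invr Xc.
    by exists n => //=; rewrite in_itv/= lerBrDr ltW.
  apply: negligible_bigcup => n; exists (X @^-1` `]-oo, c - n.+1%:R^-1]); split => //.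
    exact: mX.
  rewrite -[LHS]/(cdf X _) -cdf_fineK Flt// gtrBl invr_gt0 ltr0n//.
have -> : [set w | X w = c] = X @^-1` `]-oo, c] `\` X @^-1` `]-oo, c[.
  apply/seteqP; split => w /=; rewrite !in_itv/=.
    by move=> ->; rewrite lexx ltxx.
  by move=> [Xc /negP]; rewrite -leNgt => cX; apply/le_anti; rewrite Xc cX.
have Pc1 : P (X @^-1` `]-oo, c]) = 1%E by rewrite -[LHS]/(cdf X c) -cdf_fineK Fc.
have lec : X @^-1` `]-oo, c[ `<=` X @^-1` `]-oo, c].
  by move=> w /=; rewrite !in_itv/= => /ltW.
rewrite measureD; [|exact: mX|exact: mX|by rewrite [ltLHS]Pc1 ltry].
by rewrite (setIidr lec) [X in (X - _)%E]Pc1 [X in (_ - X)%E]PltC sube0.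
Qed.

End quantile.

(** * From expected records to moments *)

Section records_to_moments.
Context (R : realType) (d : measure_display)
    (Omega : measurableType d) (P : probability Omega R)
    (V : nat -> {RV P >-> R}) (hV : iid_uniform V)
    (d1 : measure_display) (Omega1 : measurableType d1)
    (P1 : probability Omega1 R) (X : {RV P1 >-> R}) (rho : nat -> R)
    (ndX : non_degenerate X) (hrho : expected_record_sequence V X rho).

Let Q := Defs.left_inverse (cdf X).
Let U n w := record_value (fun i => V i w) n.
Let a : measurableTypeR R -> R := fun x => fine (cdf X x).
Let mu : {sigma_finite_measure set (measurableTypeR R) -> \bar R} := lebesgue_measure.

Let ma : measurable_fun setT a.
Proof.
have mF : measurable_fun setT (fun x : R => fine (cdf X x)).
  by apply: nondecreasing_measurable => //; exact: fine_cdf_nondecreasing.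
exact: mF.
Qed.

Let a01 s : 0 <= a s <= 1. Proof. exact: fine_cdf01. Qed.

(** The Lebesgue measure of the line is infinite. Cutting the line at 0 leaves
    two bounded intervals, between 0 and Q(u), whose lengths are the positive
    and the negative part of Q(u). *)
Let phi : measurableTypeR R -> R := fun x => (0 <= x)%R%:R.
Let psi : measurableTypeR R -> R := fun x => (x < 0)%R%:R.

Let phi_psi x : phi x + psi x = 1.
Proof. by rewrite /phi /psi; case: leP => _; rewrite ?addr0 ?add0r. Qed.

Let natr_bool_indic (A : set R) (b : bool) x : (b <-> A x) -> b%:R = \1_A x :> R.
Proof.
move=> bA; rewrite indicE; congr ((nat_of_bool _)%:R).
by apply/idP/idP; [move=> /bA; exact: mem_set|rewrite inE => /bA].
Qed.

Let mphi : measurable_fun setT phi.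
Proof.
rewrite (_ : phi = \1_(`[0, +oo[%classic)); last first.
  by apply/funext => x; apply: natr_bool_indic; rewrite /= in_itv/= andbT.
exact: measurable_indic.
Qed.

Let mpsi : measurable_fun setT psi.
Proof.
rewrite (_ : psi = \1_(`]-oo, 0[%classic)); last first.
  by apply/funext => x; apply: natr_bool_indic; rewrite /= in_itv/=.
exact: measurable_indic.
Qed.

Let UpE u : 0 < u < 1 -> mass_below mu a phi u = (Num.max (Q u) 0)%:E.
Proof.
move=> u01.
pose A : set (measurableTypeR R) := `[0, Q u[%classic.
have mA : measurable A by exact: measurable_itv.
rewrite /mass_below (eq_integral (fun x => (\1_A x)%:E)); last first.
  move=> x _; congr EFin; rewrite /phi -natrM mulnb; apply: natr_bool_indic.
  by rewrite /A /= in_itv/= ![_ < _]ltNge left_inverse_cdf_le.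
rewrite integral_indic// setIT /mu/= lebesgue_measure_itv/= lte_fin -EFinB subr0.
by rewrite maxC; case: ltP.
Qed.

Let DnE u : 0 < u < 1 -> mass_above mu a psi u = (Num.max (- Q u) 0)%:E.
Proof.
move=> u01.
pose A : set (measurableTypeR R) := `[Q u, 0[%classic.
have mA : measurable A by exact: measurable_itv.
rewrite /mass_above (eq_integral (fun x => (\1_A x)%:E)); last first.
  move=> x _; congr EFin; rewrite /psi -natrM mulnb; apply: natr_bool_indic.
  by rewrite /A /= in_itv/= left_inverse_cdf_le// andbC.
rewrite integral_indic// setIT /mu/= lebesgue_measure_itv/= lte_fin -EFinB sub0r.
by rewrite maxC -oppr_gt0; case: ltP.
Qed.

Let QE u : 0 < u < 1 -> (Q u)%:E = (mass_below mu a phi u - mass_above mu a psi u)%E.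
Proof.
move=> u01; rewrite UpE// DnE// -EFinB; congr EFin.
have [Q0|/ltW Q0] := leP 0 (Q u).
  have nQ0 : - Q u <= 0 by rewrite oppr_le0.
  by rewrite (max_idPr nQ0) subr0.
have nQ0 : 0 <= - Q u by rewrite oppr_ge0.
by rewrite (max_idPl nQ0) sub0r opprK.
Qed.

Let iQ n : P.-integrable setT (fun w => (Q (U n w))%:E).
Proof. by have [] := hrho n. Qed.

Let mQ n : measurable_fun setT (fun w => Q (U n w)).
Proof. by apply/measurable_EFinP; exact: measurable_int (iQ n). Qed.

Let regU n : {ae P, forall w, 0 < U n w < 1}.
Proof. by apply: filterS (regular_path_ae hV) => w [reg _]; exact: reg. Qed.

Let mU n : measurable_fun setT (U n).
Proof. exact: measurable_record_value. Qed.

Let phi0 x : 0 <= phi x. Proof. exact: ler0n. Qed.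
Let psi0 x : 0 <= psi x. Proof. exact: ler0n. Qed.

Let Upoo n : (\int[P]_w mass_below mu a phi (U n w) < +oo)%E.
Proof.
have /integrableP[_] := iQ n; apply: le_lt_trans.
apply: ae_ge0_le_integral => //.
- by move=> w _; exact: mass_below_ge0.
- by apply: measurableT_comp (mU n); exact: measurable_mass_below.
- by apply: measurableT_comp => //; exact/measurable_EFinP.
- apply: filterS (regU n) => w Uw _.
  by rewrite UpE// lee_fin ge_max ler_norm normr_ge0.
Qed.

Let Dnoo n : (\int[P]_w mass_above mu a psi (U n w) < +oo)%E.
Proof.
have /integrableP[_] := iQ n; apply: le_lt_trans.
apply: ae_ge0_le_integral => //.
- by move=> w _; exact: mass_above_ge0.
- by apply: measurableT_comp (mU n); exact: measurable_mass_above.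
- by apply: measurableT_comp => //; exact/measurable_EFinP.
- apply: filterS (regU n) => w Uw _.
  by rewrite DnE// lee_fin ge_max normr_ge0 andbT -normrN ler_norm.
Qed.

(** Here phi + psi = 1: the increment is an integral over the whole line. *)
Let gain n : (\int[mu]_x (record_gain n (a x))%:E = (rho n.+1 - rho n)%:E)%E.
Proof.
have E k : (\int[P]_w (Q (U k w))%:E = (rho k)%:E)%E.
  by have [_ <-] := hrho k; rewrite unlock.
have := record_expectation_increment hV ma a01 mphi mpsi phi0 psi0 QE n mQ Upoo Dnoo.
rewrite !E (eq_integral (fun x => (record_gain n (a x))%:E)); last first.
  by move=> x _; rewrite phi_psi mul1r.
case: (\int[mu]_x _)%E => // g [->].
by congr EFin; ring.
Qed.

Let mgain n : measurable_fun setT (fun x => (record_gain n (a x))%:E).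
Proof. by apply/measurable_EFinP; exact: measurable_fun_record_gain. Qed.

(** By right continuity F stays strictly between 0 and 1 on some interval
    [x, y], where the gain is bounded below by a positive constant. *)
Lemma expected_record_increasing : rho 0%N < rho 1%N.
Proof.
have [x /andP[ax0 ax1]] := non_degenerate_cdf ndX.
have [y [xy ay1]] : exists y, x < y /\ a y < 1.
  apply: contrapT => H.
  have : 1 <= fine (cdf X x).
    apply: cdf_right_approx => y xy; rewrite leNgt; apply/negP => ay1.
    by apply: H; exists y.
  by rewrite leNgt ax1.
have L0 : 0 < - ln (1 - a x) by rewrite oppr_gt0 ln_lt0// subr_gt0 ax1 gtrBl ax0.
pose g := (1 - a y) * - ln (1 - a x).
have g0 : 0 < g by rewrite mulr_gt0 ?subr_gt0.
rewrite -subr_gt0 -lte_fin -gain.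
have gle z : x <= z <= y -> g <= record_gain 0 (a z).
  move=> /andP[xz zy].
  have axz : a x <= a z by exact: fine_cdf_nondecreasing.
  have azy : a z <= a y by exact: fine_cdf_nondecreasing.
  rewrite /record_gain expr1 divr1 ler_pM ?subr_ge0 ?(ltW ay1) ?(ltW L0)//.
    by rewrite lerD2l lerN2.
  rewrite lerN2 ler_ln ?posrE ?subr_gt0//; last exact: le_lt_trans azy ay1.
  by rewrite lerD2l lerN2.
apply: (@lt_le_trans _ _ (\int[mu]_(z in `[x, y]) g%:E)%E).
  rewrite integral_cst//= /mu/= lebesgue_measure_itv/= lte_fin xy.
  by rewrite -EFinB -EFinM lte_fin mulr_gt0// subr_gt0.
apply: (@le_trans _ _ (\int[mu]_(z in `[x, y]) (record_gain 0 (a z))%:E)%E).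
  apply: ge0_le_integral => //.
  - by move=> z _; rewrite lee_fin ltW.
  - exact: measurable_funTS.
apply: ge0_subset_integral => //.
by move=> z _; rewrite lee_fin record_gain_ge0.
Qed.

Let c := rho 1%N - rho 0%N.
Let c0 : 0 < c. Proof. by rewrite subr_gt0; exact: expected_record_increasing. Qed.

Let D x := record_gain 0 (a x) / c.
Let T x := - ln (1 - a x).

Let T0 x : 0 <= T x. Proof. exact: neg_ln_onem_ge0. Qed.

Let mT : measurable_fun setT T.
Proof.
rewrite /T; apply: measurableT_comp => //; apply: measurableT_comp => //.
exact: measurable_funB.
Qed.

Let D0 x : 0 <= D x.
Proof. by rewrite divr_ge0 ?record_gain_ge0// ltW. Qed.

Let mD : measurable_fun setT D.
Proof. by apply: measurable_funM => //; exact: measurable_fun_record_gain. Qed.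

(** T^n times the density T * (1 - F) / c is [record_gain] n up to the
    factor (n+1)! / c. *)
Let momentE n : (\int[mu]_x ((T x ^+ n)%:E * (D x)%:E) =
  ((rho n.+1 - rho n) * n.+1`!%:R / c)%:E)%E.
Proof.
under eq_integral => x _.
  rewrite -EFinM (_ : T x ^+ n * D x = n.+1`!%:R / c * record_gain n (a x)); last first.
    rewrite /D /record_gain -/(T x) expr1 divr1 exprS; field.
    by rewrite pnatr_eq0 -lt0n fact_gt0 gt_eqF.
  rewrite EFinM; over.
rewrite ge0_integralZl_EFin//.
- by rewrite gain -EFinM; congr EFin; rewrite mulrC mulrA.
- by move=> x _; rewrite lee_fin record_gain_ge0.
- by rewrite divr_ge0// ltW.
Qed.

Let D1 : (\int[mu]_x (D x)%:E = 1)%E.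
Proof.
have := momentE 0; rewrite mulr1 divff ?gt_eqF// => <-.
by apply: eq_integral => x _; rewrite expr0 mul1e.
Qed.

Theorem records_moment_sequence :
  exists (d2 : measure_display) (Omega2 : measurableType d2)
          (P2 : probability Omega2 R) (T : {RV P2 >-> R}),
     [/\ P2 [set w | 0 < T w] = 1%E,
         (forall n : nat,
            P2.-integrable setT (EFin \o (fun w => T w ^+ n))) &
         (forall n : nat,
            (rho n.+1 - rho n) / (rho 1%N - rho 0%N) =
            fine ('E_P2[(fun w => T w ^+ n)%R]%E) / (n.+1)`!%:R)].
Proof.
have [P2 P2E] := density_probP mD D0 D1.
pose TRV : {RV P2 >-> R} :=
  HB.pack T (isMeasurableFun.Build _ _ _ _ (T : measurableTypeR R -> R) mT).
have mTn n : measurable_fun setT (EFin \o (fun w => TRV w ^+ n)).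
  by apply/measurable_EFinP; exact: measurable_funX.
have Tn0 n x : (0 <= (T x ^+ n)%:E)%E by rewrite lee_fin exprn_ge0.
have ETn n : (\int[P2]_w (T w ^+ n)%:E =
    ((rho n.+1 - rho n) * n.+1`!%:R / c)%:E)%E.
  by rewrite P2E//; exact: (mTn n).
have mpos : measurable [set x : measurableTypeR R | 0 < T x].
  exact: measurable_set_lt.
exists _, (measurableTypeR R), P2, TRV; split.
- rewrite -[LHS]mul1e -[X in P2 X]setIT -[in LHS]integral_indic//.
  rewrite P2E//; last by apply/measurable_EFinP; exact: measurable_indic.
  rewrite mul1e -[RHS]D1; apply: eq_integral => x _.
  rewrite indicE; case: (boolP (x \in _)); first by rewrite mul1e.
  rewrite notin_setE/= => /negP; rewrite -leNgt => Tx0.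
  have Tx : T x = 0 by apply/le_anti; rewrite Tx0 T0.
  by rewrite mul0e /D /record_gain -/(T x) Tx expr1 mul0r mulr0 mul0r.
- move=> n; apply/integrableP; split => //.
  rewrite (eq_integral (fun w => (T w ^+ n)%:E)); last first.
    by move=> x _; rewrite /= ger0_norm// exprn_ge0.
  by rewrite ETn ltry.
- move=> n; rewrite unlock ETn /= -/c mulrAC mulfK//.
Qed.
End records_to_moments.

(** * Left continuity and the quantile transform *)

Section left_seq.
Context (R : realType).
Implicit Types (u x : R).

(** A sequence increasing to u from the left and staying in [u / 2, u). *)
Definition left_seq (u : R) n := u - u / 2 * harmonic n.

Lemma left_seq_cvg u : left_seq u n @[n --> \oo] --> u.
Proof.
rewrite -[X in _ --> X]subr0 -[X in _ - X](mulr0 (u / 2)).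
apply: cvgB; first exact: cvg_cst.
by apply: cvgM; [exact: cvg_cst|exact: cvg_harmonic].
Qed.

Lemma left_seq_lt u n : 0 < u -> left_seq u n < u.
Proof. by move=> u0; rewrite gtrBl mulr_gt0 ?divr_gt0// harmonic_gt0. Qed.

Lemma left_seq_ge u n : 0 < u -> u / 2 <= left_seq u n.
Proof.
move=> u0; rewrite /left_seq.
have h1 : harmonic n <= 1 :> R by rewrite /harmonic/= invf_le1 ?ler1n.
have : u / 2 * harmonic n <= u / 2 * 1 by rewrite ler_wpM2l// divr_ge0// ltW.
lra.
Qed.

Lemma left_seq_near u x : 0 < u -> \forall n \near \oo, (x < left_seq u n) = (x < u).
Proof.
move=> u0; have [xu|ux] := ltP x u; last first.
  by apply: nearW => n; apply/negbTE; rewrite -leNgt (le_trans _ ux)// ltW// left_seq_lt.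
by have /cvgr_gt/(_ _ xu) := @left_seq_cvg u.
Qed.

End left_seq.

Section mass_left_continuous.
Context (R : realType) (ds : measure_display) (S : measurableType ds)
    (mu : {sigma_finite_measure set S -> \bar R})
    (a : S -> R) (ma : measurable_fun setT a)
    (phi : S -> R) (mphi : measurable_fun setT phi) (phi0 : forall s, 0 <= phi s).

Let mweight (b : S -> bool) : measurable_fun setT b ->
  measurable_fun setT (fun s => (phi s * (b s)%:R)%:E).
Proof.
move=> mb; apply/measurable_EFinP; apply: measurable_funM => //.
exact: measurable_natr_bool.
Qed.

(** Dominated convergence for the indicators of the level sets, which are
    eventually constant at every point. *)
Let weighted_cvg (b : R -> bool) (bn : nat -> R -> bool) (bdom : R -> bool) :
  (forall s, \forall n \near \oo, bn n (a s) = b (a s)) ->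
  (forall n s, bn n (a s) -> bdom (a s)) ->
  (forall n, measurable_fun setT (fun s => bn n (a s))) ->
  measurable_fun setT (fun s => bdom (a s)) ->
  (\int[mu]_s (phi s * (bdom (a s))%:R)%:E < +oo)%E ->
  (\int[mu]_s (phi s * (bn n (a s))%:R)%:E)%E @[n --> \oo] -->
  (\int[mu]_s (phi s * (b (a s))%:R)%:E)%E.
Proof.
move=> bnb bnd mbn mdom domoo.
apply: (@dominated_cvg _ _ _ _ _ measurableT _ _
  (fun s => (phi s * (bdom (a s))%:R)%:E)) => //.
- by move=> n; exact: mweight.
- move=> s _; apply: cvg_near_cst.
  by apply: filterS (bnb s) => n ->.
- apply/integrableP; split; first exact: mweight.
  rewrite (eq_integral (fun s => (phi s * (bdom (a s))%:R)%:E)) // => s _.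
  by rewrite /= ger0_norm// mulr_ge0.
- move=> n s _; rewrite /= ger0_norm ?mulr_ge0// lee_fin ler_wpM2l//.
  by have := bnd n s; case: (bn n _) => // /(_ isT) ->.
Qed.

(** Left continuity comes from the strict inequality in a(s) < u; the
    complementary test u <= a(s) has the same property. *)
Lemma cvg_mass_below_left u : 0 < u -> (mass_below mu a phi u < +oo)%E ->
  mass_below mu a phi (left_seq u n) @[n --> \oo] --> mass_below mu a phi u.
Proof.
move=> u0 fin; apply: (weighted_cvg (b := fun x => x < u)
    (bn := fun n x => x < left_seq u n) (bdom := fun x => x < u)) => //.
+ by move=> s; exact: left_seq_near.
+ by move=> n s /lt_trans; apply; exact: left_seq_lt.
+ by move=> n; exact: measurable_fun_ltr.
+ exact: measurable_fun_ltr.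
Qed.

Lemma cvg_mass_above_left u : 0 < u -> (mass_above mu a phi (u / 2) < +oo)%E ->
  mass_above mu a phi (left_seq u n) @[n --> \oo] --> mass_above mu a phi u.
Proof.
move=> u0 fin; apply: (weighted_cvg (b := fun x => u <= x)
    (bn := fun n x => left_seq u n <= x) (bdom := fun x => u / 2 <= x)) => //.
+ by move=> s; apply: filterS (left_seq_near (a s) u0) => n; rewrite !leNgt => ->.
+ by move=> n s; apply: le_trans; exact: left_seq_ge.
+ by move=> n; exact: measurable_fun_ler.
+ exact: measurable_fun_ler.
Qed.

Let mass_weight_le (b b' : S -> bool) : (forall s, b s -> b' s) ->
  measurable_fun setT b -> measurable_fun setT b' ->
  (\int[mu]_s (phi s * (b s)%:R)%:E <= \int[mu]_s (phi s * (b' s)%:R)%:E)%E.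
Proof.
move=> bb' mb mb'.
apply: ge0_le_integral => //; try exact: mweight.
- by move=> s _; rewrite lee_fin mulr_ge0.
- move=> s _; rewrite lee_fin ler_wpM2l//.
  by have := bb' s; case: (b s) => // /(_ isT) ->.
Qed.

Lemma mass_below_nondecreasing u v : u <= v ->
  (mass_below mu a phi u <= mass_below mu a phi v)%E.
Proof.
move=> uv; apply: mass_weight_le.
- by move=> s /lt_le_trans; apply.
- exact: measurable_fun_ltr.
- exact: measurable_fun_ltr.
Qed.

Lemma mass_above_nonincreasing u v : u <= v ->
  (mass_above mu a phi v <= mass_above mu a phi u)%E.
Proof.
move=> uv; apply: mass_weight_le.
- by move=> s; exact: le_trans.
- exact: measurable_fun_ler.
- exact: measurable_fun_ler.
Qed.

End mass_left_continuous.

Section quantile_transform.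
Context (R : realType) (d : measure_display)
    (Omega : measurableType d) (P : probability Omega R)
    (W : {RV P >-> R})
    (unifW : forall A : set R, measurable A ->
      P (W @^-1` A) = uniform_prob (@ltr01 R) A).
Context (g : R -> R)
  (g_nd : forall u v, 0 < u -> u <= v -> v < 1 -> g u <= g v)
  (g_lc : forall u x, 0 < u < 1 -> (forall v, 0 < v < u -> g v <= x) -> g u <= x)
  (X : {RV P >-> R}) (XE : forall w, X w = g (W w)).

Let mW (A : set R) : measurable A -> measurable (W @^-1` A).
Proof. by move=> mA; exact: measurable_funPTI. Qed.

Let mX (A : set R) : measurable A -> measurable (X @^-1` A).
Proof. by move=> mA; exact: measurable_funPTI. Qed.

Let uniform_oc u : 0 < u < 1 -> P (W @^-1` `]0, u]) = u%:E.
Proof.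
move=> /andP[u0 u1]; rewrite unifW// uniform_prob01E// (setIidl _).
  by rewrite lebesgue_measure_itv/= lte_fin u0 -EFinB subr0.
move=> y /=; rewrite !in_itv/= => /andP[/ltW-> yu].
by rewrite (le_trans yu (ltW u1)).
Qed.

Let uniform_co v : 0 < v < 1 -> P (W @^-1` `[v, 1[) = (1 - v)%:E.
Proof.
move=> /andP[v0 v1]; rewrite unifW// uniform_prob01E// (setIidl _).
  by rewrite lebesgue_measure_itv/= lte_fin v1.
move=> y /=; rewrite !in_itv/= => /andP[vy /ltW->].
by rewrite (le_trans (ltW v0) vy).
Qed.

(** It suffices that u <= F(x) and g(u) <= x are equivalent. If g(u) <= x, then
    g(W) <= x as soon as 0 < W <= u, an event of probability u. If x < g(u), left
    continuity gives v < u with x < g(v), and then g(W) <= x forces W to lie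
    outside [v, 1), an event of probability v. *)
Lemma quantile_transform u : 0 < u < 1 -> Defs.left_inverse (cdf X) u = g u.
Proof.
move=> u01; have /andP[u0 u1] := u01.
have key x : (Defs.left_inverse (cdf X) u <= x) = (g u <= x).
  rewrite left_inverse_cdf_le// -lee_fin cdf_fineK.
  apply/idP/idP => [uF|gx]; last first.
    rewrite -(uniform_oc u01); apply: le_measure; rewrite ?inE; [exact: mW|exact: mX|].
    move=> w /=; rewrite !in_itv/= XE => /andP[W0 Wu].
    exact: le_trans (g_nd W0 Wu u1) gx.
  apply: g_lc => // v /andP[v0 vu]; rewrite leNgt; apply/negP => xgv.
  have v1 := lt_trans vu u1; have v01 : 0 < v < 1 by rewrite v0.
  have : (cdf X x <= P (~` (W @^-1` `[v, 1%R[)))%E.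
    rewrite -[cdf X x]/(P (X @^-1` `]-oo, x])).
    apply: le_measure; rewrite ?inE; [exact: mX|by apply: measurableC; exact: mW|].
    move=> w /=; rewrite !in_itv/= XE => gx /andP[vW W1].
    by have := le_lt_trans (le_trans (g_nd v0 vW W1) gx) xgv; rewrite ltxx.
  rewrite probability_setC; last exact: mW.
  rewrite [X in (1 - X)%E]uniform_co// -EFinB subKr => /(le_trans uF).
  by rewrite lee_fin leNgt vu.
by apply/le_anti; rewrite key lexx -key lexx.
Qed.

End quantile_transform.

Section measurable_left_inverse.
Context (R : realType) (d : measure_display) (Omega : measurableType d)
  (P : probability Omega R) (X : {RV P >-> R}).

(** The infimum is then taken over the whole line or over the empty set, and
    both have the default value 0. *)
Lemma left_inverse_cdf_out u : u <= 0 \/ 1 < u -> Defs.left_inverse (cdf X) u = 0.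
Proof.
move=> [u0|u1]; apply: inf_out => -[[y Ay] [z zlb]].
  have : z <= z - 1 by apply: zlb; rewrite /= (le_trans _ (cdf_ge0 _ _)) ?lee_fin.
  lra.
by move: Ay => /= /le_trans/(_ (cdf_le1 _ _)); rewrite lee_fin leNgt u1.
Qed.

(** The integrability of a record requires measurability on the whole space,
    hence also where the record value falls outside (0, 1). *)
Lemma measurable_left_inverse_cdf (g : R -> R) : measurable_fun setT g ->
  (forall u, 0 < u < 1 -> Defs.left_inverse (cdf X) u = g u) ->
  measurable_fun setT (Defs.left_inverse (cdf X)).
Proof.
move=> mg gE; set q := Defs.left_inverse _ in gE *.
rewrite (_ : q = fun u => if (0 < u) && (u < 1) then g u else
                          if u == 1 then q 1 else 0); last first.
  apply/funext => u; case: ifPn => [u01|]; first by rewrite gE.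
  rewrite negb_and -!leNgt; case: eqP => [-> //|/eqP u1 /orP[u0|]].
    by apply: left_inverse_cdf_out; left.
  by rewrite le_eqVlt eq_sym (negbTE u1)/= => ?; apply: left_inverse_cdf_out; right.
apply: measurable_fun_if => //.
- by apply: measurable_and; exact: measurable_fun_ltr.
- exact: measurable_funTS.
- apply: measurable_funTS; apply: measurable_fun_if => //.
  exact: measurable_fun_eqr.
Qed.

End measurable_left_inverse.

(** * From moments to expected records *)

Section moments_to_records.
Context (R : realType) (d : measure_display)
    (Omega : measurableType d) (P : probability Omega R)
    (V : nat -> {RV P >-> R}) (hV : iid_uniform V)
    (d2 : measure_display) (Omega2 : measurableType d2)
    (P2 : probability Omega2 R) (T : {RV P2 >-> R}) (rho : nat -> R)
    (rho01 : rho 0%N < rho 1%N)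
    (Tpos : P2 [set w | 0 < T w] = 1%E)
    (Tmom : forall n, P2.-integrable setT (EFin \o (fun w => T w ^+ n)))
    (rhoE : forall n, (rho n.+1 - rho n) / (rho 1%N - rho 0%N) =
       fine ('E_P2[(fun w => T w ^+ n)%R]%E) / (n.+1)`!%:R).

Let U n w := record_value (fun i => V i w) n.
Let mu : {sigma_finite_measure set Omega2 -> \bar R} := P2.
Let c := rho 1%N - rho 0%N.
Let c0 : 0 < c. Proof. by rewrite subr_gt0. Qed.

(** The level a is the value of F at a point where L(F) = T, and the weight is
    the density c * e^t / t taken at t = T. The cut at T = 1 separates its two
    possible singularities. *)
Let a w := if 0 < T w then 1 - expR (- T w) else 0.
Let weight w := c * expR (T w) / T w.
Let phi w := if 1 <= T w then weight w else 0.
Let psi w := if (0 < T w) && (T w < 1) then weight w else 0.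

Let mT : measurable_fun setT T. Proof. exact: measurable_funPT. Qed.

Let ma : measurable_fun setT a.
Proof.
apply: measurable_fun_ifT => //; first exact: measurable_fun_ltr.
apply: measurable_funB => //; apply: measurableT_comp => //.
exact: measurableT_comp.
Qed.

Let mweight : measurable_fun setT weight.
Proof.
apply: measurable_funM; first by apply: measurable_funM => //; exact: measurableT_comp.
by apply: measurableT_comp => //; exact: measurable_invr.
Qed.

Let mphi : measurable_fun setT phi.
Proof. by apply: measurable_fun_ifT => //; exact: measurable_fun_ler. Qed.

Let mpsi : measurable_fun setT psi.
Proof.
apply: measurable_fun_ifT => //.
by apply: measurable_and; exact: measurable_fun_ltr.
Qed.

Let a01 w : 0 <= a w <= 1.
Proof.
rewrite /a; case: ltP => [T0|_]; last by rewrite lexx ler01.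
by rewrite subr_ge0 expR_le1 oppr_le0 (ltW T0) gerBl expR_ge0.
Qed.

Let weight_ge0 w : 0 < T w -> 0 <= weight w.
Proof. by move=> T0; rewrite divr_ge0 ?mulr_ge0 ?expR_ge0// ltW. Qed.

Let phi0 w : 0 <= phi w.
Proof. by rewrite /phi; case: ifP => // T1; rewrite weight_ge0// (lt_le_trans _ T1). Qed.

Let psi0 w : 0 <= psi w.
Proof. by rewrite /psi; case: ifP => // /andP[T0 _]; exact: weight_ge0. Qed.

Let log_a w : 0 < T w -> - ln (1 - a w) = T w.
Proof. by move=> T0; rewrite /a T0 subKr expRK opprK. Qed.

(** The factors T and e^(-T) of the gain cancel the weight. *)
Let weight_gain n w : 0 < T w ->
  weight w * record_gain n (a w) = c / n.+1`!%:R * T w ^+ n.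
Proof.
move=> T0; rewrite /record_gain log_a// /weight /a T0 subKr expRN exprS.
field; rewrite pnatr_eq0 -lt0n fact_gt0/= gt_eqF ?expR_gt0//.
by rewrite gt_eqF.
Qed.

Let integral_bounded (f : Omega2 -> R) (M : R) : measurable_fun setT f ->
  (forall w, 0 <= f w) -> (forall w, f w <= M) -> (\int[mu]_w (f w)%:E < +oo)%E.
Proof.
move=> mf f0 fM; apply: (@le_lt_trans _ _ (\int[mu]_w (cst M%:E) w)%E).
  apply: ge0_le_integral => //.
  - by move=> w _; rewrite lee_fin.
  - exact/measurable_EFinP.
  - by move=> w _; rewrite lee_fin.
by rewrite integral_cst// /mu [X in (_ * X)%E]probability_setT mule1 ltry.
Qed.

(** On the event T >= 1 and a < u, the weight is at most c * e^T, and a < u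
    means e^T < 1 / (1 - u). *)
Let below_fin u : 0 < u < 1 -> (mass_below mu a phi u < +oo)%E.
Proof.
move=> /andP[u0 u1]; apply: (integral_bounded (M := c / (1 - u))).
- apply: measurable_funM => //; apply: measurable_natr_bool.
  exact: measurable_fun_ltr.
- by move=> w; rewrite mulr_ge0.
- move=> w; have M0 : 0 <= c / (1 - u) by rewrite divr_ge0 ?subr_ge0 ?ltW//.
  rewrite /phi; case: ifP => T1; last by rewrite mul0r.
  have T0 : 0 < T w by rewrite (lt_le_trans _ T1).
  case: ltP => au; last by rewrite mulr0.
  rewrite mulr1 /weight -mulrA ler_pM2l//.
  rewrite ler_pdivrMr// (@le_trans _ _ (1 - u)^-1)//; last first.
    by rewrite ler_peMr// invr_ge0 subr_ge0 ltW.
  rewrite -[expR _]invrK lef_pV2 ?posrE ?invr_gt0 ?expR_gt0 ?subr_gt0//.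
  by move: au; rewrite /a T0 expRN; lra.
Qed.

Let a_le w : 0 < T w -> a w <= T w.
Proof. by move=> T0; rewrite /a T0; have := expR_ge1Dx (- T w); lra. Qed.

(** On the event T < 1 and u <= a, the weight is at most c * e / T, and
    T >= a >= u. *)
Let above_fin u : 0 < u < 1 -> (mass_above mu a psi u < +oo)%E.
Proof.
move=> /andP[u0 u1]; apply: (integral_bounded (M := c * expR 1 / u)).
- apply: measurable_funM => //; apply: measurable_natr_bool.
  exact: measurable_fun_ler.
- by move=> w; rewrite mulr_ge0.
- move=> w; have M0 : 0 <= c * expR 1 / u by rewrite divr_ge0 ?mulr_ge0 ?expR_ge0 ?ltW.
  rewrite /psi; case: ifP => [/andP[T0 T1]|_]; last by rewrite mul0r.
  case: (leP u (a w)) => ua; last by rewrite mulr0.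
  rewrite mulr1 /weight ler_pM ?mulr_ge0 ?expR_ge0 ?invr_ge0 ?(ltW T0)//.
    exact: ltW.
    by rewrite ler_pM2l// ler_expR ltW.
  by rewrite lef_pV2// (le_trans ua)// a_le.
Qed.

Let moment n : (\int[mu]_w (T w ^+ n)%:E)%E =
  (fine ('E_P2[(fun w => T w ^+ n)%R]%E))%:E.
Proof.
by rewrite unlock fineK//; exact: (integrable_fin_num measurableT (Tmom n)).
Qed.

Let Tpos_ae : {ae P2, forall w, 0 < T w}.
Proof.
have mpos : measurable [set w | 0 < T w] by exact: measurable_set_lt.
exists (~` [set w | 0 < T w]); split => //; first exact: measurableC.
by rewrite [LHS](probability_setC P2)// Tpos subee.
Qed.

Let phi_psi_gain n : {ae P2, forall w,
  (phi w + psi w) * record_gain n (a w) = c / n.+1`!%:R * T w ^+ n}.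
Proof.
apply: filterS Tpos_ae => w T0; rewrite -weight_gain//; congr (_ * _).
by rewrite /phi /psi T0/=; case: leP => _; rewrite ?addr0 ?add0r.
Qed.

Let mgain n : measurable_fun setT (fun w => record_gain n (a w)).
Proof. exact: measurable_fun_record_gain. Qed.

Let gainE n : (\int[mu]_w ((phi w + psi w) * record_gain n (a w))%:E)%E =
  (rho n.+1 - rho n)%:E.
Proof.
rewrite (ae_eq_integral (fun w => (c / n.+1`!%:R)%:E * (T w ^+ n)%:E)%E) //; last 3 first.
- by apply/measurable_EFinP; apply: measurable_funM => //; exact: measurable_funD.
- by apply: emeasurable_funM => //; apply/measurable_EFinP; exact: measurable_funX.
- by apply: filterS (phi_psi_gain n) => w /= -> _; rewrite EFinM.
rewrite (integralZl measurableT (Tmom n)) [X in (_ * X)%E](moment n) -EFinM; congr EFin.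
have := rhoE n; rewrite -/c => /(canRL (divfK (lt0r_neq0 c0))) ->.
by rewrite mulrC mulrA mulrAC.
Qed.

(** For n = 0 the integrand is c / T, bounded by c where T >= 1; each further
    step adds at most the finite increment of rho. *)
Let below_oo n : (\int[P]_w mass_below mu a phi (U n w) < +oo)%E.
Proof.
elim: n => [|n IH].
  rewrite (integral_mass_below hV)//; apply: (integral_bounded (M := c)).
  - by apply: measurable_funM => //; exact: measurable_fun_record_survival.
  - by move=> w; rewrite mulr_ge0 ?record_survival_ge0.
  - move=> w; rewrite /record_survival /phi; case: ifP => T1; last by rewrite mul0r ltW.
    have T0 : 0 < T w by rewrite (lt_le_trans _ T1).
    rewrite /expsum big_ord1 expr0 fact0 divr1 mulr1 /weight /a T0 subKr expRN.
    rewrite mulrAC mulfK ?gt_eqF ?expR_gt0// ler_pdivrMr// ler_peMr//.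
    exact: ltW.
rewrite (integral_mass_belowS hV)// lte_add_pinfty//.
apply: (@le_lt_trans _ _ (rho n.+1 - rho n)%:E); last exact: ltry.
rewrite -gainE; apply: ge0_le_integral => //.
- by move=> w _; rewrite lee_fin mulr_ge0// record_gain_ge0.
- by apply/measurable_EFinP; exact: measurable_funM.
- by apply/measurable_EFinP; apply: measurable_funM => //; exact: measurable_funD.
- by move=> w _; rewrite lee_fin ler_wpM2r ?record_gain_ge0// lerDl.
Qed.

(** Each step lowers the mass above. For n = 0 the integrand is the weight times
    a, at most c * e since a <= T < 1. *)
Let above_oo n : (\int[P]_w mass_above mu a psi (U n w) < +oo)%E.
Proof.
elim: n => [|n IH].
  rewrite (integral_mass_above hV)//; apply: (integral_bounded (M := c * expR 1)).
  - apply: measurable_funM => //; apply: measurable_funB => //.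
    exact: measurable_fun_record_survival.
  - by move=> w; rewrite mulr_ge0 ?subr_ge0 ?(record_survival_le1 hV).
  - move=> w; rewrite /record_survival /psi; case: ifP => [/andP[T0 T1]|_]; last first.
      by rewrite mul0r mulr_ge0 ?expR_ge0 ?ltW.
    rewrite /expsum big_ord1 expr0 fact0 divr1 mulr1 subKr /weight.
    rewrite -mulrA -[leRHS]mulr1.
    rewrite ler_pM ?mulr_ge0 ?expR_ge0 ?invr_ge0 ?(ltW T0) ?(ltW c0)//.
    + by have /andP[] := a01 w.
    + by rewrite ler_pM2l// ler_expR ltW.
    + by rewrite mulrC ler_pdivrMr// mul1r a_le.
move: IH; rewrite (integral_mass_aboveS hV)//; apply: le_lt_trans.
rewrite leeDl// integral_ge0// => w _.
by rewrite lee_fin mulr_ge0 ?record_gain_ge0.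
Qed.

Let Q0 u := fine (mass_below mu a phi u) - fine (mass_above mu a psi u).

Let below_num u : 0 < u < 1 -> mass_below mu a phi u \is a fin_num.
Proof. by move=> u01; rewrite ge0_fin_numE ?below_fin//; exact: mass_below_ge0. Qed.

Let above_num u : 0 < u < 1 -> mass_above mu a psi u \is a fin_num.
Proof. by move=> u01; rewrite ge0_fin_numE ?above_fin//; exact: mass_above_ge0. Qed.

Let Q0E u : 0 < u < 1 -> (Q0 u)%:E = (mass_below mu a phi u - mass_above mu a psi u)%E.
Proof. by move=> u01; rewrite EFinB !fineK ?below_num ?above_num. Qed.

Let mQ0 : measurable_fun setT Q0.
Proof.
apply: measurable_funB; apply: (measurableT_comp (fine_measurable measurableT)).
- exact: measurable_mass_below.
- exact: measurable_mass_above.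
Qed.

Let mU n : measurable_fun setT (U n).
Proof. exact: measurable_record_value. Qed.

Let mQ0U n : measurable_fun setT (fun w => Q0 (U n w)).
Proof. exact: measurableT_comp. Qed.

Let iQ0 n := (record_expectationE hV ma mphi mpsi phi0 psi0 Q0E
  (mQ0U n) (below_oo n) (above_oo n)).1.

Let Q0_increment n : (\int[P]_w (Q0 (U n.+1 w))%:E =
  \int[P]_w (Q0 (U n w))%:E + (rho n.+1 - rho n)%:E)%E.
Proof.
rewrite -gainE; exact: (record_expectation_increment hV ma a01 mphi mpsi phi0 psi0
  Q0E n mQ0U below_oo above_oo).
Qed.

(** The constant gives the first record the expectation rho 0. *)
Let k := rho 0%N - fine (\int[P]_w (Q0 (U 0%N w))%:E)%E.
Let g u := Q0 u + k.

Let mg : measurable_fun setT g. Proof. exact: measurable_funD. Qed.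

Let g_expectation n : (\int[P]_w (g (U n w))%:E)%E = (rho n)%:E.
Proof.
rewrite /g; under eq_integral do rewrite EFinD.
rewrite integralD//; last 2 first.
- exact: iQ0.
- exact: finite_measure_integrable_cst.
rewrite [X in (_ + X)%E](_ : _ = k%:E); last first.
  by rewrite (integral_cst P measurableT k%:E) [X in (_ * X)%E]probability_setT mule1.
elim: n => [|n IH].
  rewrite -[X in (X + _)%E]fineK; last exact: (integrable_fin_num measurableT (iQ0 0%N)).
  by rewrite -EFinD /k; congr EFin; ring.
by rewrite Q0_increment addeAC IH -EFinD; congr EFin; ring.
Qed.

Let g_nd u v : 0 < u -> u <= v -> v < 1 -> g u <= g v.
Proof.
move=> u0 uv v1; have u01 : 0 < u < 1 by rewrite u0 (le_lt_trans uv).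
have v01 : 0 < v < 1 by rewrite (lt_le_trans u0).
rewrite lerD2r lerB// fine_le ?below_num ?above_num//.
- exact: mass_below_nondecreasing.
- exact: mass_above_nonincreasing.
Qed.

Let g_lc u x : 0 < u < 1 -> (forall v, 0 < v < u -> g v <= x) -> g u <= x.
Proof.
move=> u01 H; have /andP[u0 u1] := u01.
have u201 : 0 < u / 2 < 1 by lra.
have cg : g (left_seq u n) @[n --> \oo] --> g u.
  apply: cvgD; last exact: cvg_cst.
  apply: cvgB; apply: fine_cvg; rewrite fineK ?below_num ?above_num//.
  - by apply: cvg_mass_below_left => //; exact: below_fin.
  - by apply: cvg_mass_above_left => //; exact: above_fin.
rewrite -(cvg_lim _ cg)//; apply: limr_le; first by apply/cvg_ex; exists (g u).
apply: nearW => n; apply: H; rewrite left_seq_lt//.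
by rewrite (lt_le_trans _ (left_seq_ge n u0))// divr_gt0.
Qed.

(** X = g(V_0), on the space of the uniform sequence itself. By the quantile
    transform its records are almost surely g(U_n). If X were constant they
    would all be equal, against rho 0 < rho 1. *)
Theorem moments_record_sequence :
  exists (d1 : measure_display) (Omega1 : measurableType d1)
          (P1 : probability Omega1 R) (X : {RV P1 >-> R}),
      non_degenerate X /\ expected_record_sequence V X rho.
Proof.
have mX : measurable_fun setT (fun w => g (V 0%N w)) by exact: measurableT_comp.
pose X : {RV P >-> R} := HB.pack (fun w => g (V 0%N w))
  (isMeasurableFun.Build _ _ _ _ _ mX).
have unifV0 (A : set R) : measurable A -> P (V 0%N @^-1` A) = uniform_prob (@ltr01 R) A.
  exact: hV.2.
have XE w : X w = g (V 0%N w) by [].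
have quant := quantile_transform unifV0 g_nd g_lc XE.
have mL := measurable_left_inverse_cdf mg quant.
have mR n : measurable_fun setT (fun w => (record_of V X n w)%:E).
  by apply/measurable_EFinP; apply: (measurableT_comp mL); exact: mU.
have Rg n : {ae P, forall w, setT w -> (record_of V X n w)%:E = (g (U n w))%:E}.
  apply: filterS (regular_path_ae hV) => w [reg _] _.
  by rewrite /record_of quant//; exact: reg.
have mgU n : measurable_fun setT (fun w => (g (U n w))%:E).
  by apply/measurable_EFinP; exact: measurableT_comp.
have igU n : P.-integrable setT (fun w => (g (U n w))%:E).
  rewrite /g; under eq_fun do rewrite EFinD.
  by apply: integrableD => //; [exact: iQ0|exact: finite_measure_integrable_cst].
have rec : expected_record_sequence V X rho.
  move=> n; split.
    apply/integrableP; split; first exact: mR.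
    have /integrableP[_] := igU n; apply: le_lt_trans.
    rewrite (ae_eq_integral (abse \o (fun w => (g (U n w))%:E)))//.
    - by apply: measurableT_comp => //; exact: mR.
    - exact: measurableT_comp.
    - by apply: filterS (Rg n) => w h tw; exact: (congr1 abse (h tw)).
  by rewrite unlock (ae_eq_integral _ _ measurableT (mR n) (mgU n) (Rg n)) g_expectation.
exists d, Omega, P, X; split => // -[x Xx].
have Rx n : rho n = x.
  have [_] := rec n.
  have Rc : {ae P, forall w, setT w -> (record_of V X n w)%:E = cst x%:E w}.
    apply: filterS (regular_path_ae hV) => w [reg _] _.
    by rewrite /record_of (left_inverse_cdf_const Xx)//; exact: reg.
  rewrite unlock (ae_eq_integral _ _ measurableT (mR n) _ Rc)//.
  rewrite (integral_cst P measurableT x%:E) [X in (_ * X)%E]probability_setT mule1.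
  by move=> [].
by move: rho01; rewrite !Rx ltxx.
Qed.

End moments_to_records.

(** * The characterization *)

Theorem theorem1p1 (R : realType) (d : measure_display)
    (Omega : measurableType d) (P : probability Omega R)
    (V : nat -> {RV P >-> R}) (hV : iid_uniform V) (rho : nat -> R) :
  (exists (d1 : measure_display) (Omega1 : measurableType d1)
          (P1 : probability Omega1 R) (X : {RV P1 >-> R}),
      non_degenerate X /\ expected_record_sequence V X rho)
  <->
  (rho 0%N < rho 1%N /\
   exists (d2 : measure_display) (Omega2 : measurableType d2)
          (P2 : probability Omega2 R) (T : {RV P2 >-> R}),
     [/\ P2 [set w | 0 < T w] = 1%E,
         (forall n : nat,
            P2.-integrable setT (EFin \o (fun w => T w ^+ n))) &
         (forall n : nat,
            (rho n.+1 - rho n) / (rho 1%N - rho 0%N) =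
            fine ('E_P2[(fun w => T w ^+ n)%R]%E) / (n.+1)`!%:R)]).
Proof.
split=> [[d1 [S1 [P1 [X [ndX hX]]]]]|[rho01 [d2 [S2 [P2 [T [Tpos Tmom rhoE]]]]]]].
  split; first exact: (expected_record_increasing hV ndX hX).
  exact: (records_moment_sequence hV ndX hX).
exact: (moments_record_sequence hV rho01 Tpos Tmom rhoE).
Qed.
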